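(* Let $M^2$ be a proper-biharmonic constant mean curvature surface in the unit Euclidean sphere $\mathbb{S}^4$. Then $M^2$ is minimal in $\mathbb{S}^3(\tfrac{1}{\sqrt 2})$, i.e. $M$ is a minimal surface of a hypersphere $\mathbb{S}^3(\tfrac{1}{\sqrt 2})\subset\mathbb{S}^4$ of radius $\tfrac{1}{\sqrt 2}$.
   Context: $\mathbb{S}^n$ denotes the unit sphere in $\mathbb{R}^{n+1}$ with its standard metric of constant sectional curvature $1$. A hypersphere $\mathbb{S}^3(\tfrac{1}{\sqrt 2})$ of $\mathbb{S}^4$ is a set of the form $\{x\in\mathbb{S}^4 : \langle x,v\rangle=\tfrac{1}{\sqrt 2}\}$ for some unit vector $v\in\mathbb{R}^5$; it is a round $3$-sphere of radius $\tfrac{1}{\sqrt 2}$. For a smooth map $\varphi:(M,g)\to(N,h)$ between Riemannian manifolds, the tension field is $\tau(\varphi)=\operatorname{trace}\nabla d\varphi$, and $\varphi$ is harmonic if $\tau(\varphi)=0$. Biharmonic maps are the critical points of the bienergy $E_2(\varphi)=\frac12\int_M|\tau(\varphi)|^2\,v_g$; the Euler-Lagrange equation is the vanishing of the bitension field $$\tau_2(\varphi)=-\Delta\tau(\varphi)-\operatorname{trace}R^N(d\varphi,\tau(\varphi))d\varphi,$$ where $\Delta=-\operatorname{trace}\nabla^2$ is the rough Laplacian on sections of $\varphi^{-1}TN$ and $R^N(X,Y)=[\nabla_X,\nabla_Y]-\nabla_{[X,Y]}$ is the curvature tensor of $N$. Thus $\varphi$ is biharmonic if $\tau_2(\varphi)=0$.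 A submanifold $M$ of $N$, with the induced metric, is proper-biharmonic if its inclusion map $\varphi:M\to N$ is biharmonic but not harmonic (equivalently, $M$ is not minimal in $N$). For a submanifold $M^m$ of a Riemannian manifold, with second fundamental form $B$, the mean curvature vector field is $H=\frac1m\operatorname{trace}B$ and the mean curvature is $|H|$; the submanifold is minimal if $H=0$. For $M^m\subset\mathbb{S}^n$ one has $\tau(\varphi)=mH$ and $\tau_2(\varphi)=-m(\Delta H-mH)$, so $M$ is biharmonic if and only if $\Delta H=mH$, where $\Delta$ is the rough Laplacian on $\varphi^{-1}T\mathbb{S}^n$. Constant mean curvature means that $|H|$ is constant on $M$ (it is not assumed that $H$ is parallel in the normal bundle).
   Formalization: The surface M is assumed connected; without this the claim fails, e.g. for a disjoint union of two minimal surfaces lying in different hyperspheres S^3(1/√2). *)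

(* Defs.v *)
From HB Require Import structures.
From mathcomp Require Import all_boot all_order all_algebra.
From mathcomp Require Import all_classical all_reals all_analysis.

Set Implicit Arguments.
Unset Strict Implicit.
Unset Printing Implicit Defensive.

Import Order.TTheory GRing.Theory Num.Theory.
Import numFieldNormedType.Exports.

Local Open Scope classical_set_scope.
Local Open Scope ring_scope.

(* The norm of 'rV[R]_n in the library is the sup norm: it is only used through
   the topology and the derivatives it induces. The Euclidean structure is given
   by dot and enorm. *)
Definition dot (R : realType) (n : nat) (x y : 'rV[R]_n) : R :=
  (x *m y^T) 0 0.

Definition enorm (R : realType) (n : nat) (x : 'rV[R]_n) : R :=
  Num.sqrt (dot x x).

(* C^k and C^infinity on an open set U. *)
Fixpoint Ck_on (R : realType) (V W : normedModType R) (k : nat) (U : set V)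
    (f : V -> W) : Prop :=
  match k with
  | 0 => forall u, U u -> {for u, continuous f}
  | k'.+1 => (forall u, U u -> differentiable f u) /\
             (forall v : V, Ck_on k' U ('D_v f))
  end.

Definition smooth_on (R : realType) (V W : normedModType R) (U : set V)
    (f : V -> W) : Prop := forall k, Ck_on k U f.

(* A local parametrization par : dom -> M, a homeomorphism from an open subset
   of the plane onto an open subset of M, with inverse crd. *)
Record chart (R : realType) (M : topologicalType) := Chart {
  dom : set 'rV[R]_2;
  par : 'rV[R]_2 -> M;
  crd : M -> 'rV[R]_2;
  dom_open : open dom;
  parK : forall u, dom u -> crd (par u) = u;
  par_continuous : forall u, dom u -> {for u, continuous par};
  par_open : forall V : set 'rV[R]_2,
    open V -> V `<=` dom -> open (par @` V) }.

Record smooth_surface (R : realType) (M : topologicalType) := SmoothSurface {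
  atlas : set (chart R M);
  surface_hausdorff : hausdorff_space M;
  surface_second_countable : @second_countable M;
  atlas_cover : forall p : M,
    exists2 c, atlas c & (par c @` dom c) p;
  atlas_smooth : forall c c', atlas c -> atlas c' ->
    smooth_on (dom c `&` par c @^-1` (par c' @` dom c')) (crd c' \o par c) }.

Definition immersion (R : realType) (M : topologicalType)
    (S : smooth_surface R M) (phi : M -> 'rV[R]_5) : Prop :=
  forall c, atlas S c ->
    smooth_on (dom c) (phi \o par c) /\
    forall u, dom c u ->
      forall v, 'D_v (phi \o par c) u = 0 -> v = 0.

Definition S4 (R : realType) : set 'rV[R]_5 := [set x | enorm x = 1].

(* For a unit vector v, this is a hypersphere S^3(1/sqrt 2) of S4. *)
Definition hypersphere (R : realType) (v : 'rV[R]_5) : set 'rV[R]_5 :=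
  [set x | S4 x /\ dot x v = (Num.sqrt 2)^-1].

(* An ambient submanifold N of R^5 enters through P : 'rV_5 -> 'rV_5 -> 'rV_5,
   where P q is the orthogonal projection of R^5 onto T_q N; the Levi-Civita
   connection of N is the projection by P of the flat connection of R^5. *)
Definition proj_S4 (R : realType) (q w : 'rV[R]_5) : 'rV[R]_5 :=
  w - dot w q *: q.

(* The normal space in R^5 of hypersphere v at q is spanned by the orthogonal
   vectors v and q - <q, v> v. *)
Definition proj_hypersphere (R : realType) (v q w : 'rV[R]_5) : 'rV[R]_5 :=
  let e := q - dot q v *: v in
  w - dot w v *: v - (dot w e / dot e e) *: e.

Definition ambient_nabla (R : realType) (P : 'rV[R]_5 -> 'rV[R]_5 -> 'rV[R]_5)
    (X Y : 'rV[R]_5 -> 'rV[R]_5) (q : 'rV[R]_5) : 'rV[R]_5 :=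
  P q ('D_(X q) Y q).

Definition lie_bracket (R : realType) (X Y : 'rV[R]_5 -> 'rV[R]_5)
    (q : 'rV[R]_5) : 'rV[R]_5 :=
  'D_(X q) Y q - 'D_(Y q) X q.

(* R^N(x, y) z = ([nabla_X, nabla_Y] - nabla_[X, Y]) Z at q, for x, y, z in
   T_q N. As R^N is a tensor, any extensions X, Y, Z of x, y, z to vector fields
   tangent to N may be used: here, the projections of the constant fields. *)
Definition curvature (R : realType) (P : 'rV[R]_5 -> 'rV[R]_5 -> 'rV[R]_5)
    (q x y z : 'rV[R]_5) : 'rV[R]_5 :=
  let X := fun p => P p x in
  let Y := fun p => P p y in
  let Z := fun p => P p z in
  let nabla := ambient_nabla P in
  nabla X (nabla Y Z) q - nabla Y (nabla X Z) q - nabla (lie_bracket X Y) Z q.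

(* Below, f : 'rV_2 -> 'rV_5 is a surface in N read in a local parametrization,
   everything being computed in the corresponding coordinate frame. *)
Definition pd (R : realType) (W : normedModType R) (i : 'I_2)
    (f : 'rV[R]_2 -> W) : 'rV[R]_2 -> W :=
  'D_(delta_mx 0 i) f.

Definition metric (R : realType) (f : 'rV[R]_2 -> 'rV[R]_5) (u : 'rV[R]_2) :
    'M[R]_2 :=
  \matrix_(i, j) dot (pd i f u) (pd j f u).

(* Gamma^k_ij of the Levi-Civita connection of the induced metric. *)
Definition christoffel (R : realType) (f : 'rV[R]_2 -> 'rV[R]_5)
    (i j k : 'I_2) (u : 'rV[R]_2) : R :=
  let g a b := fun w => metric f w a b in
  2^-1 * \sum_l invmx (metric f u) k l *
    (pd i (g j l) u + pd j (g i l) u - pd l (g i j) u).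

Definition trace_g (R : realType) (f : 'rV[R]_2 -> 'rV[R]_5) (u : 'rV[R]_2)
    (T : 'I_2 -> 'I_2 -> 'rV[R]_5) : 'rV[R]_5 :=
  \sum_i \sum_j invmx (metric f u) i j *: T i j.

(* The connection of the pull-back bundle f^-1 TN. *)
Definition nabla_along (R : realType) (P : 'rV[R]_5 -> 'rV[R]_5 -> 'rV[R]_5)
    (f : 'rV[R]_2 -> 'rV[R]_5) (i : 'I_2) (V : 'rV[R]_2 -> 'rV[R]_5)
    (u : 'rV[R]_2) : 'rV[R]_5 :=
  P (f u) (pd i V u).

(* (nabla df)(d_i, d_j) = nabla^N_i (df d_j) - df (nabla^M_i d_j): as M carries
   the induced metric, this is also the second fundamental form B (d_i, d_j). *)
Definition second_form (R : realType) (P : 'rV[R]_5 -> 'rV[R]_5 -> 'rV[R]_5)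
    (f : 'rV[R]_2 -> 'rV[R]_5) (i j : 'I_2) (u : 'rV[R]_2) : 'rV[R]_5 :=
  nabla_along P f i (pd j f) u - \sum_k christoffel f i j k u *: pd k f u.

Definition tension (R : realType) (P : 'rV[R]_5 -> 'rV[R]_5 -> 'rV[R]_5)
    (f : 'rV[R]_2 -> 'rV[R]_5) (u : 'rV[R]_2) : 'rV[R]_5 :=
  trace_g f u (fun i j => second_form P f i j u).

Definition mean_curvature_field (R : realType)
    (P : 'rV[R]_5 -> 'rV[R]_5 -> 'rV[R]_5)
    (f : 'rV[R]_2 -> 'rV[R]_5) (u : 'rV[R]_2) : 'rV[R]_5 :=
  2^-1 *: trace_g f u (fun i j => second_form P f i j u).

Definition rough_laplacian (R : realType)
    (P : 'rV[R]_5 -> 'rV[R]_5 -> 'rV[R]_5)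
    (f : 'rV[R]_2 -> 'rV[R]_5) (V : 'rV[R]_2 -> 'rV[R]_5) (u : 'rV[R]_2) :
    'rV[R]_5 :=
  - trace_g f u (fun i j =>
      nabla_along P f i (nabla_along P f j V) u
      - \sum_k christoffel f i j k u *: nabla_along P f k V u).

Definition bitension (R : realType) (P : 'rV[R]_5 -> 'rV[R]_5 -> 'rV[R]_5)
    (f : 'rV[R]_2 -> 'rV[R]_5) (u : 'rV[R]_2) : 'rV[R]_5 :=
  - rough_laplacian P f (tension P f) u
  - trace_g f u (fun i j =>
      curvature P (f u) (pd i f u) (tension P f u) (pd j f u)).

Definition harmonic (R : realType) (M : topologicalType)
    (S : smooth_surface R M) (P : 'rV[R]_5 -> 'rV[R]_5 -> 'rV[R]_5)
    (phi : M -> 'rV[R]_5) : Prop :=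
  forall c, atlas S c -> forall u, dom c u -> tension P (phi \o par c) u = 0.

Definition biharmonic (R : realType) (M : topologicalType)
    (S : smooth_surface R M) (P : 'rV[R]_5 -> 'rV[R]_5 -> 'rV[R]_5)
    (phi : M -> 'rV[R]_5) : Prop :=
  forall c, atlas S c -> forall u, dom c u -> bitension P (phi \o par c) u = 0.

Definition proper_biharmonic (R : realType) (M : topologicalType)
    (S : smooth_surface R M) (P : 'rV[R]_5 -> 'rV[R]_5 -> 'rV[R]_5)
    (phi : M -> 'rV[R]_5) : Prop :=
  biharmonic S P phi /\ ~ harmonic S P phi.

Definition constant_mean_curvature (R : realType) (M : topologicalType)
    (S : smooth_surface R M) (P : 'rV[R]_5 -> 'rV[R]_5 -> 'rV[R]_5)
    (phi : M -> 'rV[R]_5) : Prop :=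
  exists h : R, forall c, atlas S c -> forall u, dom c u ->
    enorm (mean_curvature_field P (phi \o par c) u) = h.

Definition minimal (R : realType) (M : topologicalType)
    (S : smooth_surface R M) (P : 'rV[R]_5 -> 'rV[R]_5 -> 'rV[R]_5)
    (phi : M -> 'rV[R]_5) : Prop :=
  forall c, atlas S c -> forall u, dom c u ->
    mean_curvature_field P (phi \o par c) u = 0.

(* Main.v *)
Require Import Defs.
From HB Require Import structures.
From mathcomp Require Import all_boot all_order all_algebra.
From mathcomp Require Import all_classical all_reals all_analysis.
From mathcomp Require Import perm ring lra.
Set Implicit Arguments.
Unset Strict Implicit.
Unset Printing Implicit Defensive.
Import Order.TTheory GRing.Theory Num.Theory.
Import numFieldNormedType.Exports.
Local Open Scope classical_set_scope.
Local Open Scope ring_scope.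

(** Let f be the surface read in a chart, h its constant mean curvature, tau
    its tension field, xi = tau / 2h the unit normal in the direction of the
    mean curvature and eta the other unit normal of the surface in the sphere.
    Write b and c for the shape operators of xi and eta, so that tr b = 2h and
    tr c = 0, and w for the connection form of the normal bundle.

    The tangential part of the biharmonic equation, combined with the Codazzi
    equation for b and the constancy of tr b, says that c annihilates w. As c is
    symmetric and traceless, c = 0 wherever w <> 0; there the Codazzi equation
    for c forces det b = 0. The xi part of the biharmonic equation is
    |b|^2 + |w|^2 = 2. If w = 0, the eta part gives <b, c> = 0, and the Ricci
    equation says that b and c commute; for symmetric operators of a plane with
    tr c = 0 this leaves only b = h Id or c = 0.

    The case c = 0 is impossible on an open set when b has constant determinant d
    and distinct eigenvalues (no_parallel_shape): b is then a Codazzi tensor with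
    constant distinct eigenvalues, hence parallel, hence the surface is flat,
    whereas the Gauss equation gives the curvature 1 + d <> 0. Here d = 0 where
    w <> 0, and d = 2h^2 - 1 where w = 0. Therefore w = 0, b = h Id and, because
    |b|^2 = 2, h^2 = 1 (umbilical_along_mean_curvature). It follows that
    f + tau / 2 has derivative zero: it is locally a constant vector sqrt 2 v
    with |v| = 1. Since f is orthogonal to tau, <f, v> = 1 / sqrt 2, and the mean
    curvature vector of the surface in R^5, a multiple of tau - 2 f, is normal to
    the hypersphere of axis v: the surface is minimal in it.

    The vector v does not depend on the chart: if the surface has near a point
    constant height 1 / sqrt 2 along a unit vector v', then taking the Laplacian
    of this height gives <tau, v'> = 2 <f, v'>, whence <v, v'> = 1. So the set of
    points near which the surface has the given height along a fixed v is open and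
    closed, and connectedness concludes (axis_constant).

    All the geometry is done by the method of moving frames, on real-valued
    functions: the rows of an orthonormal frame of R^5 are f, two tangent vectors
    e_1 and e_2, xi and eta; the derivations D_1 and D_2 are the derivatives along
    e_1 and e_2; the equations of Gauss, Codazzi and Ricci are the entries of one
    matrix identity (structure_equation). *)

(** * Smooth real-valued functions *)

Section SmoothFunctions.
Context {R : realType} {V : normedModType R}.
Implicit Types (U : set V) (f g : V -> R).

Lemma near_eq_differentiable f g (x : V) :
  {near x, f =1 g} -> differentiable f x -> differentiable g x.
Proof.
move=> fg fx; have [dfc fE] := (diff_locallyP _ _).1 fx.
have gE : g \o shift x = cst (g x) + 'd f x +o_ 0 id.
  apply/eqaddoP => e e0; move/eqaddoP: fE => /(_ e e0).
  have : \forall y \near (0 : V), f (y + x) = g (y + x).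
    have : y + x @[y --> (0 : V)] --> 0 + x by apply: cvgD; [exact: cvg_id|exact: cvg_cst].
    by rewrite add0r => /(_ _ fg).
  apply: filterS2 => y /= fgy; rewrite !fctE /= -fgy.
  by rewrite -(nbhs_singleton fg).
by apply/diff_locallyP; rewrite (diff_unique dfc gE).
Qed.

Lemma derive_mul f g u v : derivable f u v -> derivable g u v ->
  'D_v (fun u => f u * g u) u = 'D_v f u * g u + f u * 'D_v g u.
Proof. by move=> df dg; rewrite addrC [_ * g u]mulrC; exact: deriveM df dg. Qed.

Lemma Ck_onW k U f : Ck_on k.+1 U f -> Ck_on k U f.
Proof.
elim: k f => [|k IH] f /= [df Df]; first by move=> u /df /differentiable_continuous.
by split=> // v; apply: IH; exact: Df.
Qed.

Lemma near_open U (x : V) (P : V -> Prop) :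
  open U -> U x -> (forall y, U y -> P y) -> \forall y \near x, P y.
Proof. by move=> oU Ux UP; apply: filterS UP _; exact: open_nbhs_nbhs. Qed.

Lemma Ck_on_ext k U f g : open U -> (forall u, U u -> f u = g u) ->
  Ck_on k U f -> Ck_on k U g.
Proof.
move=> oU; elim: k f g => [|k IH] f g fg /=.
  move=> fc u Uu; rewrite /prop_for /continuous_at -fg //.
  by apply: cvg_trans (fc u Uu); apply: near_eq_cvg; apply: near_open Uu fg.
move=> [df Df]; split=> [u Uu|v].
  by apply: near_eq_differentiable (df u Uu); apply: near_open Uu fg.
apply: IH (Df v) => u Uu; apply: near_eq_derive; exact: near_open Uu fg.
Qed.

Lemma Ck_on_cst k U (c : R) : open U -> Ck_on k U (fun=> c).
Proof.
move=> oU; elim: k c => [|k IH] c /=; first by move=> u _; exact: cvg_cst.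
split=> [u _|v]; first exact: differentiable_cst.
apply: Ck_on_ext (IH 0) => // u _; by rewrite (derive_cst c).
Qed.

Lemma Ck_onD k U f g : open U -> Ck_on k U f -> Ck_on k U g ->
  Ck_on k U (fun u => f u + g u).
Proof.
move=> oU; elim: k f g => [|k IH] f g /=.
  by move=> fc gc u Uu; apply: cvgD; [exact: fc|exact: gc].
move=> [df Df] [dg Dg]; split=> [u Uu|v].
  by apply: differentiableD; [exact: df|exact: dg].
apply: Ck_on_ext (IH _ _ (Df v) (Dg v)) => // u Uu.
by rewrite -deriveD //; apply: diff_derivable; [exact: df|exact: dg].
Qed.

Lemma Ck_onM k U f g : open U -> Ck_on k U f -> Ck_on k U g ->
  Ck_on k U (fun u => f u * g u).
Proof.
move=> oU; elim: k f g => [|k IH] f g.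
  by move=> fc gc u Uu; apply: cvgM; [exact: fc|exact: gc].
move=> Cf Cg; have [df Df] := Cf; have [dg Dg] := Cg; split=> [u Uu|v].
  by apply: differentiableM; [exact: df|exact: dg].
have := Ck_onD oU (IH _ _ (Ck_onW Cf) (Dg v)) (IH _ _ (Ck_onW Cg) (Df v)).
apply: Ck_on_ext => // u Uu.
rewrite addrC [g u * _]mulrC; apply/esym/derive_mul; apply: diff_derivable.
  exact: df.
exact: dg.
Qed.

Lemma rsqrt_differentiable U f u : (forall u, U u -> 0 < f u) -> U u ->
  differentiable f u -> differentiable (fun u => (Num.sqrt (f u))^-1) u.
Proof.
move=> f0 Uu df; apply: (@differentiable_comp _ _ _ _ f (fun x => (Num.sqrt x)^-1)) => //.
apply/derivable1_diffP/derivableV; first by rewrite sqrtr_eq0 -ltNge f0.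
by have [] := is_derive1_sqrt (f0 u Uu).
Qed.

Lemma rsqrtP (x : R) : 0 < x -> (Num.sqrt x)^-1 * (Num.sqrt x)^-1 * x = 1.
Proof.
move=> x0; rewrite -invfM -expr2 sqr_sqrtr ?ltW // mulVf //.
by rewrite gt_eqF.
Qed.

(** Differentiate r^2 f = 1, and multiply by r to get rid of f. *)
Lemma derive_rsqrt U f u v : open U -> (forall u, U u -> 0 < f u) -> U u ->
  (forall u, U u -> differentiable f u) ->
  let r := fun u => (Num.sqrt (f u))^-1 in
  'D_v r u = - 2^-1 * (r u * r u * r u * 'D_v f u).
Proof.
move=> oU f0 Uu df r.
have dr : derivable r u v by apply/diff_derivable/(rsqrt_differentiable f0 Uu)/df.
have dfu : derivable f u v by apply/diff_derivable/df.
have rr y : U y -> r y * r y * f y = 1 by move=> Uy; exact: rsqrtP (f0 y Uy).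
clearbody r.
have drr : derivable (fun u => r u * r u) u v := derivableM dr dr.
have := derive_mul drr dfu; rewrite (derive_mul dr dr).
have -> : 'D_v (fun u => r u * r u * f u) u = 0.
  rewrite -(derive_cst (1 : R) u v); apply: near_eq_derive.
  exact: near_open Uu rr.
move: (rr u Uu); move: (r u) ('D_v r u) ('D_v f u) (f u) => a b c d H1 H2.
have : a * ((b * a + a * b) * d + a * a * c) = a * a * a * c + 2 * b * (a * a * d) by ring.
by rewrite H1 -H2; lra.
Qed.

(** The derivative of f^(-1/2) is a polynomial in f^(-1/2) and the derivative of
    f, so that one order of regularity is gained at each step. *)
Lemma Ck_on_rsqrt k U f : open U -> (forall u, U u -> 0 < f u) ->
  Ck_on k U f -> Ck_on k U (fun u => (Num.sqrt (f u))^-1).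
Proof.
move=> oU f0; elim: k => [|k IH].
  move=> cf u Uu; apply: cvgV; first by rewrite sqrtr_eq0 -ltNge f0.
  by apply: continuous_comp; [exact: cf|exact: sqrt_continuous].
move=> Cf; have [df Df] := Cf; split=> [u Uu|v].
  exact: rsqrt_differentiable Uu (df u Uu).
have Cr := IH (Ck_onW Cf).
have C2 : Ck_on k U (fun=> - 2^-1 : R) by exact: Ck_on_cst.
have := Ck_onM oU C2 (Ck_onM oU (Ck_onM oU (Ck_onM oU Cr Cr) Cr) (Df v)).
by apply: Ck_on_ext => // u Uu; rewrite (derive_rsqrt v oU f0 Uu df).
Qed.

Section Rules.
Context (U : set V) (oU : open U).

Lemma smooth_ext f g : (forall u, U u -> f u = g u) -> smooth_on U f ->
  smooth_on U g.
Proof. by move=> fg sf k; apply: Ck_on_ext (sf k). Qed.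

Lemma smooth_cst (c : R) : smooth_on U (fun=> c).
Proof. by move=> k; exact: Ck_on_cst. Qed.

Lemma smoothD f g : smooth_on U f -> smooth_on U g ->
  smooth_on U (fun u => f u + g u).
Proof. by move=> sf sg k; apply: Ck_onD. Qed.

Lemma smoothM f g : smooth_on U f -> smooth_on U g ->
  smooth_on U (fun u => f u * g u).
Proof. by move=> sf sg k; apply: Ck_onM. Qed.

Lemma smoothN f : smooth_on U f -> smooth_on U (fun u => - f u).
Proof.
move=> sf; apply: smooth_ext (smoothM (smooth_cst (-1)) sf) => u _.
by rewrite mulN1r.
Qed.

Lemma smoothB f g : smooth_on U f -> smooth_on U g ->
  smooth_on U (fun u => f u - g u).
Proof. by move=> sf sg; apply: smoothD => //; exact: smoothN. Qed.

Lemma smooth_sum (I : finType) (F : I -> V -> R) :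
  (forall i, smooth_on U (F i)) -> smooth_on U (fun u => \sum_i F i u).
Proof.
move=> sF; elim: (index_enum I) => [|i s IH].
  by apply: smooth_ext (smooth_cst 0) => u _; rewrite big_nil.
by apply: smooth_ext (smoothD (sF i) IH) => u _; rewrite big_cons.
Qed.

Lemma smooth_prod (I : finType) (F : I -> V -> R) :
  (forall i, smooth_on U (F i)) -> smooth_on U (fun u => \prod_i F i u).
Proof.
move=> sF; elim: (index_enum I) => [|i s IH].
  by apply: smooth_ext (smooth_cst 1) => u _; rewrite big_nil.
by apply: smooth_ext (smoothM (sF i) IH) => u _; rewrite big_cons.
Qed.

Lemma smooth_rsqrt f : (forall u, U u -> 0 < f u) -> smooth_on U f ->
  smooth_on U (fun u => (Num.sqrt (f u))^-1).
Proof. by move=> f0 sf k; apply: Ck_on_rsqrt. Qed.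

Lemma smooth_derive (W : normedModType R) (f : V -> W) v :
  smooth_on U f -> smooth_on U ('D_v f).
Proof. by move=> sf k; have [_] := sf k.+1; apply. Qed.

Lemma smooth_diff (W : normedModType R) (f : V -> W) u :
  smooth_on U f -> U u -> differentiable f u.
Proof. by move=> sf; have [+ _] := sf 1%N; apply. Qed.

Lemma smooth_derivable (W : normedModType R) (f : V -> W) u v :
  smooth_on U f -> U u -> derivable f u v.
Proof. by move=> sf Uu; apply/diff_derivable/smooth_diff. Qed.

Lemma derive_ext (W : normedModType R) (f g : V -> W) u v :
  (forall u, U u -> f u = g u) -> U u -> 'D_v f u = 'D_v g u.
Proof. by move=> fg Uu; apply: near_eq_derive; exact: (near_open oU Uu fg). Qed.

Lemma sderiveD f g u v : smooth_on U f -> smooth_on U g -> U u ->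
  'D_v (fun u => f u + g u) u = 'D_v f u + 'D_v g u.
Proof. by move=> sf sg Uu; exact: (@deriveD _ _ R^o f g u v
  (smooth_derivable sf Uu) (smooth_derivable sg Uu)). Qed.

Lemma sderiveM f g u v : smooth_on U f -> smooth_on U g -> U u ->
  'D_v (fun u => f u * g u) u = 'D_v f u * g u + f u * 'D_v g u.
Proof.
move=> sf sg Uu.
exact: derive_mul (smooth_derivable sf Uu) (smooth_derivable sg Uu).
Qed.

Lemma sderiveN f u v : smooth_on U f -> U u ->
  'D_v (fun u => - f u) u = - 'D_v f u.
Proof. by move=> sf Uu; exact: (@deriveN _ _ R^o f u v (smooth_derivable sf Uu)). Qed.

Lemma sderive_sum (I : finType) (F : I -> V -> R) u v :
  (forall i, smooth_on U (F i)) -> U u ->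
  'D_v (fun u => \sum_i F i u) u = \sum_i 'D_v (F i) u.
Proof.
move=> sF Uu; elim: (index_enum I) => [|i s IH].
  rewrite [RHS]big_nil -[RHS](derive_cst (0 : R) u v); apply: derive_ext => // y _.
  by rewrite big_nil.
rewrite big_cons -IH -sderiveD //.
  by apply: derive_ext => // y _; rewrite big_cons.
elim: s {IH} => [|j s IH].
  by apply: smooth_ext (smooth_cst 0) => y _; rewrite big_nil.
by apply: smooth_ext (smoothD (sF j) IH) => y _; rewrite big_cons.
Qed.

End Rules.

End SmoothFunctions.

(** * Symmetry of second derivatives *)

Section Lines.
Context {R : realType} {V : normedModType R}.
Implicit Types (U : set V) (f g : V -> R).

Lemma is_derive_line f (a v : V) (s : R) : differentiable f (s *: v + a) ->
  is_derive s 1 (fun s => f (s *: v + a)) ('D_v f (s *: v + a)).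
Proof.
move=> df; have E : (fun h : R => h^-1 *: (f ((h *: 1 + s) *: v + a) - f (s *: v + a)))
    = (fun h : R => h^-1 *: (f (h *: v + (s *: v + a)) - f (s *: v + a))).
  apply/funext => h; congr (_ *: (f _ - _)).
  by rewrite scalerDl addrA [h%:A]mulr1.
apply: DeriveDef; last by rewrite /derive /= E.
by rewrite /derivable /= E; exact: diff_derivable df.
Qed.

Lemma MVT_line f (a v : V) (t : R) : 0 < t ->
  (forall s, 0 <= s <= t -> differentiable f (s *: v + a)) ->
  exists2 c, 0 < c < t & f (t *: v + a) - f a = t * 'D_v f (c *: v + a).
Proof.
move=> t0 df.
have [||c] := @MVT R (fun s => f (s *: v + a)) (fun s => 'D_v f (s *: v + a)) 0 t t0.
- move=> x; rewrite in_itv /= => /andP[x0 xt].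
  by apply: is_derive_line; apply: df; rewrite !ltW.
- apply: derivable_within_continuous => x; rewrite in_itv /= => xt.
  by have [] := is_derive_line (df x xt).
rewrite in_itv /= scale0r add0r subr0 mulrC => ct ->; by exists c.
Qed.

(** Two applications of the mean value theorem, along v to the difference of f
    between two parallel segments, then along w to the derivative so obtained. *)
Lemma second_difference f (u v w : V) (t : R) : 0 < t ->
  (forall s r, 0 <= s <= t -> 0 <= r <= t ->
    differentiable f (r *: w + (s *: v + u)) /\
    differentiable ('D_v f) (r *: w + (s *: v + u))) ->
  exists s r, [/\ 0 < s < t, 0 < r < t &
    f (t *: w + (t *: v + u)) - f (t *: v + u) - f (t *: w + u) + f u =
      t * (t * 'D_w ('D_v f) (r *: w + (s *: v + u)))].
Proof.
move=> t0 df; have tt : 0 <= t <= t by rewrite ltW /=.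
have z0 : 0 <= (0 : R) <= t by rewrite lexx ltW.
have d1 s : 0 <= s <= t -> is_derive s 1 (fun s => f (s *: v + (t *: w + u)))
    ('D_v f (s *: v + (t *: w + u))).
  move=> st; apply: is_derive_line; rewrite addrCA.
  by have [] := df s t st tt.
have d2 s : 0 <= s <= t -> is_derive s 1 (fun s => f (s *: v + u))
    ('D_v f (s *: v + u)).
  move=> st; apply: is_derive_line.
  by have [] := df s 0 st z0; rewrite scale0r add0r.
have d3 s : 0 <= s <= t -> is_derive s 1
    (fun s => f (s *: v + (t *: w + u)) - f (s *: v + u))
    ('D_v f (s *: v + (t *: w + u)) - 'D_v f (s *: v + u)).
  by move=> st; have := is_deriveB (d1 s st) (d2 s st).
have [||s st E] := @MVT R (fun s => f (s *: v + (t *: w + u)) - f (s *: v + u))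
  (fun s => 'D_v f (s *: v + (t *: w + u)) - 'D_v f (s *: v + u)) 0 t t0.
- by move=> x; rewrite in_itv /= => /andP[x0 xt]; apply: d3; rewrite !ltW.
- apply: derivable_within_continuous => x; rewrite in_itv /= => xt.
  by have [] := d3 x xt.
move: st; rewrite in_itv /= => st.
have sle : 0 <= s <= t by case/andP: st => ? ?; rewrite !ltW.
have [|r rt E2] := @MVT_line ('D_v f) (s *: v + u) w t t0.
  by move=> r rt; have [] := df s r sle rt.
exists s, r; split => //; rewrite -E2 (addrCA (t *: w)) [t *: w + (s *: v + u)]addrCA.
move: E; rewrite !scale0r !add0r subr0 => E.
by rewrite [RHS]mulrC -E; ring.
Qed.

(** The second difference is symmetric in v and w; it is t^2 times either mixed
    derivative at a point that tends to u with t. *)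
Lemma schwarz U f (u v w : V) : open U -> smooth_on U f -> U u ->
  'D_v ('D_w f) u = 'D_w ('D_v f) u.
Proof.
move=> oU sf Uu.
have cont a b : {for u, continuous ('D_a ('D_b f))}.
  by apply: differentiable_continuous; apply: (smooth_diff _ Uu); do 2 apply: smooth_derive.
apply/eqP; rewrite -subr_eq0 -normr_le0; apply/ler_addgt0Pr => e e0; rewrite add0r.
have e20 : 0 < e / 2 by rewrite divr_gt0.
have : \forall y \near u, [/\ U y, `|'D_v ('D_w f) u - 'D_v ('D_w f) y| < e / 2 &
                            `|'D_w ('D_v f) u - 'D_w ('D_v f) y| < e / 2].
  have N a b : \forall y \near u, `|'D_a ('D_b f) u - 'D_a ('D_b f) y| < e / 2.
    by move/cvgrPdist_lt : (cont a b) => /(_ _ e20).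
  have NU : nbhs u U by exact: open_nbhs_nbhs (conj oU Uu).
  by apply: filterS3 NU (N v w) (N w v) => y *; split.
move/nbhs_ballP => [d /= d0 Hd].
pose t := d / (`|v| + `|w| + 1) / 2.
have n0 : 0 < `|v| + `|w| + 1 by rewrite ltr_wpDl // addr_ge0.
have t0 : 0 < t by rewrite !divr_gt0.
have ballt s r : 0 <= s <= t -> 0 <= r <= t -> ball u d (r *: w + (s *: v + u)).
  move=> /andP[s0 st] /andP[r0 rt]; rewrite -ball_normE /= distrC addrA addrK.
  rewrite (le_lt_trans (ler_normD _ _)) // !normrZ !ger0_norm //.
  apply: (@le_lt_trans _ _ (t * (`|v| + `|w|))).
    by rewrite mulrDr addrC lerD // ler_wpM2r.
  have tn : t * (`|v| + `|w| + 1) = d / 2.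
    by rewrite /t mulrAC divfK // gt_eqF.
  apply: (@le_lt_trans _ _ (d / 2)); last by rewrite ltr_pdivrMr // ltr_pMr // ltr1n.
  by rewrite -tn ler_wpM2l ?ltW // ltrDl.
have dball y a : ball u d y -> differentiable f y /\ differentiable ('D_a f) y.
  move=> /Hd [Uy _ _]; split; apply: (smooth_diff _ Uy) => //; exact: smooth_derive.
have [|s [r [/andP[s0 st] /andP[r0 rt] E1]]] := @second_difference f u v w t t0.
  by move=> s r st rt; apply: dball; exact: ballt.
have [|s' [r' [/andP[s0' st'] /andP[r0' rt'] E2]]] := @second_difference f u w v t t0.
  by move=> s' r' st' rt'; apply: dball; rewrite addrCA; exact: ballt.
have in_cc (x : R) : 0 < x -> x < t -> 0 <= x <= t by move=> ? ?; rewrite !ltW.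
have E : 'D_w ('D_v f) (r *: w + (s *: v + u)) = 'D_v ('D_w f) (r' *: v + (s' *: w + u)).
  have tn0 : t != 0 by rewrite gt_eqF.
  move: E1 E2; rewrite (addrCA (t *: v)) (addrAC (f _)) => -> /(mulfI tn0) /(mulfI tn0).
  by [].
have [_ _ H1] := Hd _ (ballt s r (in_cc _ s0 st) (in_cc _ r0 rt)).
have [_ H2 _] := Hd _ (ballt r' s' (in_cc _ r0' rt') (in_cc _ s0' st')).
move: H1 H2; rewrite E addrCA => H1 H2.
have -> : e = e / 2 + e / 2 by rewrite -splitr.
apply: le_trans (ler_distD ('D_v ('D_w f) (s' *: w + (r' *: v + u))) _ _) _.
by apply: lerD; [exact: ltW H2|rewrite distrC; exact: ltW H1].
Qed.

End Lines.

(** * Coordinates *)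

Section Coordinates.
Context {R : realType} {V : normedModType R}.

Lemma derive_coord n (F : V -> 'rV[R]_n) (u v : V) j : derivable F u v ->
  ('D_v F u) 0 j = 'D_v (fun x => F x 0 j) u.
Proof. by move=> dF; rewrite derive_mx // mxE. Qed.

Lemma smooth_coord n (U : set V) (F : V -> 'rV[R]_n) j : open U ->
  smooth_on U F -> smooth_on U (fun x => F x 0 j).
Proof.
move=> oU sF k; elim: k F sF => [|k IH] F sF.
  move=> u Uu; apply: (@continuous_comp _ _ _ F (fun x : 'rV[R]_n => x 0 j)).
    exact: (sF 0%N).
  exact: coord_continuous.
split=> [u Uu|v].
  apply: (@differentiable_comp _ _ _ _ F (fun x : 'rV[R]_n => x 0 j)).
    exact: smooth_diff sF Uu.
  exact: differentiable_coord.
apply: Ck_on_ext (IH _ (smooth_derive v sF)) => // u Uu.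
by rewrite derive_coord //; exact: smooth_derivable sF Uu.
Qed.

End Coordinates.

Section LocallyConstant.
Context {R : realType} (n : nat).
Local Notation V := 'rV[R]_n.+1.

Lemma locally_constant (U : set V) (f : V -> R) : open U ->
  (forall u, U u -> differentiable f u) ->
  (forall i u, U u -> 'D_(delta_mx 0 i) f u = 0) ->
  forall u, U u -> \forall y \near u, f y = f u.
Proof.
move=> oU df Df u Uu.
have D0 w y : U y -> 'D_w f y = 0.
  move=> Uy; rewrite (deriveE _ (df y Uy)) [w]row_sum_delta linear_sum big1 // => i _.
  by rewrite linearZ -(deriveE _ (df y Uy)) Df //; exact: mulr0.
have /nbhs_ballP [e /= e0 He] : nbhs u U by exact: open_nbhs_nbhs (conj oU Uu).
apply/nbhs_ballP; exists e => //= y uy.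
have line s : 0 <= s <= 1 -> U (s *: (y - u) + u).
  move=> /andP[s0 s1]; apply: He; move: uy.
  rewrite -!ball_normE /= opprD addrCA subrr addr0 normrN normrZ ger0_norm // distrC.
  by apply: le_lt_trans; rewrite ler_piMl.
have [|c /andP[c0 c1]] := @MVT_line R _ f u (y - u) 1 ltr01.
  by move=> s /line /df.
rewrite scale1r subrK D0 ?mulr0; last by apply: line; rewrite !ltW.
by move/eqP; rewrite subr_eq0 => /eqP.
Qed.

End LocallyConstant.

(** * Partial derivatives and derivations of the plane *)

(** Locked, like the other operators on functions below: the tactics ring and lra
    then compare applications of them as atoms instead of unfolding them. *)
HB.lock Definition pder (R : realType) (i : 'I_2) (g : 'rV[R]_2 -> R) (u : 'rV[R]_2) : R :=
  'D_(delta_mx 0 i) g u.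

Section PartialDerivatives.
Context {R : realType}.
Local Notation V := 'rV[R]_2.
Context (U : set V) (oU : open U).
Implicit Types f g : V -> R.

Lemma pderE i g : pder i g = 'D_(delta_mx 0 i) g.
Proof. by apply/funext => u; rewrite pder.unlock. Qed.

Lemma smooth_pder i g : smooth_on U g -> smooth_on U (pder i g).
Proof. by rewrite pderE; exact: smooth_derive. Qed.

Lemma pder_ext i f g u : (forall u, U u -> f u = g u) -> U u ->
  pder i f u = pder i g u.
Proof. by move=> fg Uu; rewrite !pderE; exact: (derive_ext oU _ fg Uu). Qed.

Lemma pderM i f g u : smooth_on U f -> smooth_on U g -> U u ->
  pder i (fun u => f u * g u) u = pder i f u * g u + f u * pder i g u.
Proof. by move=> sf sg Uu; rewrite !pderE; exact: sderiveM. Qed.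

Lemma pder_sum i (I : finType) (F : I -> V -> R) u :
  (forall j, smooth_on U (F j)) -> U u ->
  pder i (fun u => \sum_j F j u) u = \sum_j pder i (F j) u.
Proof.
move=> sF Uu; rewrite pderE (sderive_sum oU _ sF Uu).
by apply: eq_bigr => j _; rewrite pderE.
Qed.

Lemma pder_cst i (c : R) u : pder i (fun=> c) u = 0.
Proof. by rewrite pderE (derive_cst c). Qed.

Lemma pderC i j g u : smooth_on U g -> U u -> pder i (pder j g) u = pder j (pder i g) u.
Proof. by move=> sg Uu; rewrite !pderE; exact: schwarz oU sg Uu. Qed.

Lemma pderD i f g u : smooth_on U f -> smooth_on U g -> U u ->
  pder i (fun u => f u + g u) u = pder i f u + pder i g u.
Proof. by move=> sf sg Uu; rewrite !pderE; exact: sderiveD. Qed.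

Lemma pderN i f u : smooth_on U f -> U u ->
  pder i (fun u => - f u) u = - pder i f u.
Proof. by move=> sf Uu; rewrite !pderE; exact: sderiveN. Qed.

End PartialDerivatives.

(** The derivation along the a-th vector field, whose i-th coordinate is m a i. *)
HB.lock Definition frame_derive (R : realType) (m : 'I_2 -> 'I_2 -> 'rV[R]_2 -> R)
    (a : 'I_2) (g : 'rV[R]_2 -> R) (u : 'rV[R]_2) : R :=
  \sum_i m a i u * pder i g u.

(** theta_a(A, B) = <D_a E_A, E_B> for the frame of R^n whose A-th vector has the
    coordinates E A k. *)
HB.lock Definition connection_form (R : realType)
    (m : 'I_2 -> 'I_2 -> 'rV[R]_2 -> R) (n : nat)
    (E : 'I_n -> 'I_n -> 'rV[R]_2 -> R) (a : 'I_2) (A B : 'I_n) (u : 'rV[R]_2) : R :=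
  \sum_k frame_derive m a (E A k) u * E B k u.

Section FrameDerivations.
Context {R : realType}.
Local Notation V := 'rV[R]_2.
Implicit Types (f g : V -> R) (W : set V).

Lemma sum2 (A : nmodType) (F : 'I_2 -> A) : \sum_i F i = F 0 + F 1.
Proof.
rewrite !big_ord_recl big_ord0 addr0; congr (_ + F _); exact: val_inj.
Qed.

Lemma frame_deriveE (m : 'I_2 -> 'I_2 -> V -> R) a g :
  frame_derive m a g = fun u => \sum_i m a i u * pder i g u.
Proof. by rewrite frame_derive.unlock. Qed.

Context (U : set V) (oU : open U) (m : 'I_2 -> 'I_2 -> V -> R).
Hypothesis sm : forall a i, smooth_on U (m a i).
Local Notation D := (frame_derive m).

Lemma smooth_frame_derive a g : smooth_on U g -> smooth_on U (D a g).
Proof.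
move=> sg; rewrite frame_deriveE; apply: smooth_sum => // i; apply: smoothM => //.
exact: smooth_pder.
Qed.

Lemma frame_derive_ext W a f g u : open W -> (forall u, W u -> f u = g u) ->
  W u -> D a f u = D a g u.
Proof.
move=> oW fg Wu; rewrite !frame_deriveE; apply: eq_bigr => i _; congr (_ * _).
exact: (pder_ext oW _ fg Wu).
Qed.

Lemma frame_derive_cst a (c : R) u : D a (fun=> c) u = 0.
Proof.
by rewrite !frame_deriveE big1 // => i _; rewrite pder_cst mulr0.
Qed.

Lemma frame_deriveD a f g u : smooth_on U f -> smooth_on U g -> U u ->
  D a (fun u => f u + g u) u = D a f u + D a g u.
Proof.
move=> sf sg Uu; rewrite !frame_deriveE -big_split; apply: eq_bigr => i _ /=.
by rewrite (pderD _ sf sg Uu) mulrDr.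
Qed.

Lemma frame_deriveM a f g u : smooth_on U f -> smooth_on U g -> U u ->
  D a (fun u => f u * g u) u = D a f u * g u + f u * D a g u.
Proof.
move=> sf sg Uu; rewrite !frame_deriveE mulr_suml mulr_sumr -big_split.
by apply: eq_bigr => i _ /=; rewrite (pderM _ sf sg Uu); ring.
Qed.

Lemma frame_deriveN a f u : smooth_on U f -> U u ->
  D a (fun u => - f u) u = - D a f u.
Proof.
move=> sf Uu; rewrite !frame_deriveE -sumrN; apply: eq_bigr => i _ /=.
by rewrite (pderN _ sf Uu) mulrN.
Qed.

Lemma frame_deriveB a f g u : smooth_on U f -> smooth_on U g -> U u ->
  D a (fun u => f u - g u) u = D a f u - D a g u.
Proof.
move=> sf sg Uu; rewrite frame_deriveD ?frame_deriveN //.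
exact: smoothN.
Qed.

Lemma frame_derive_sum a (I : finType) (F : I -> V -> R) u :
  (forall i, smooth_on U (F i)) -> U u ->
  D a (fun u => \sum_i F i u) u = \sum_i D a (F i) u.
Proof.
move=> sF Uu; under [RHS]eq_bigr do rewrite frame_deriveE.
rewrite frame_deriveE exchange_big; apply: eq_bigr => i _ /=.
by rewrite (pder_sum oU _ sF Uu) mulr_sumr.
Qed.

End FrameDerivations.

(** * Connection form and structure equation of an orthonormal frame *)

Section OrthonormalFrame.
Context {R : realType}.
Local Notation V := 'rV[R]_2.
Context (U : set V) (oU : open U) (m : 'I_2 -> 'I_2 -> V -> R).
Hypothesis sm : forall a i, smooth_on U (m a i).
Local Notation D := (frame_derive m).

Context (n : nat) (E : 'I_n -> 'I_n -> V -> R).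
Hypothesis sE : forall A k, smooth_on U (E A k).
Hypothesis E_orth : forall A B u, U u -> \sum_k E A k u * E B k u = (A == B)%:R.

Local Notation theta := (connection_form m E).

Lemma connection_formE a A B :
  theta a A B = fun u => \sum_k D a (E A k) u * E B k u.
Proof. by rewrite connection_form.unlock. Qed.

Let sDE a A k : smooth_on U (D a (E A k)).
Proof. exact: smooth_frame_derive. Qed.

Lemma smooth_connection_form a A B : smooth_on U (theta a A B).
Proof. by rewrite connection_formE; apply: smooth_sum => // k; exact: smoothM. Qed.

Lemma frame_orthT k l u : U u -> \sum_A E A k u * E A l u = (k == l)%:R.
Proof.
move=> Uu; pose M : 'M[R]_n := \matrix_(A, k) E A k u.
have : M *m M^T = 1%:M.
  by apply/matrixP => A B; rewrite !mxE -(E_orth A B Uu); apply: eq_bigr => ? _; rewrite !mxE.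
move/mulmx1C/matrixP/(_ k l); rewrite !mxE => <-.
by apply: eq_bigr => ? _; rewrite !mxE.
Qed.

Lemma frame_expand (X : 'I_n -> R) k u : U u ->
  X k = \sum_B (\sum_l X l * E B l u) * E B k u.
Proof.
move=> Uu; under eq_bigr do rewrite mulr_suml.
rewrite exchange_big /= (bigD1 k) //= [X in _ + X]big1 => [|l lk].
  by under eq_bigr do rewrite -mulrA; rewrite -mulr_sumr frame_orthT // eqxx mulr1 addr0.
by under eq_bigr do rewrite -mulrA; rewrite -mulr_sumr frame_orthT // (negPf lk) mulr0.
Qed.

Lemma frame_parseval (X Y : 'I_n -> R) u : U u ->
  \sum_k X k * Y k = \sum_B (\sum_l X l * E B l u) * (\sum_l Y l * E B l u).
Proof.
move=> Uu; under eq_bigr => k _ do rewrite (frame_expand X k Uu) mulr_suml.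
rewrite exchange_big; apply: eq_bigr => B _ /=.
by rewrite mulr_sumr; apply: eq_bigr => k _; ring.
Qed.

Lemma connection_form_skew a A B u : U u -> theta a B A u = - theta a A B u.
Proof.
move=> Uu; apply/eqP; rewrite -addr_eq0; apply/eqP.
rewrite -[RHS](frame_derive_cst m a ((A == B)%:R) u).
have <- : D a (fun u => \sum_k E A k u * E B k u) u = D a (fun=> (A == B)%:R) u.
  by apply: (frame_derive_ext m a oU _ Uu) => v Uv; exact: E_orth.
rewrite (frame_derive_sum oU _ _ _ Uu); last by move=> k; exact: smoothM.
rewrite !connection_formE -big_split; apply: eq_bigr => k _ /=.
by rewrite (frame_deriveM _ _ _ _ Uu) //; ring.
Qed.

(** Differentiate <D_b E_A, E_B>; the remaining term <D_b E_A, D_a E_B> is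
    expanded in the frame by Parseval's identity. *)
Lemma frame_second_derive a b A B u : U u ->
  \sum_k D a (D b (E A k)) u * E B k u =
  D a (theta b A B) u - \sum_C theta b A C u * theta a B C u.
Proof.
move=> Uu; apply/eqP; rewrite eq_sym subr_eq; apply/eqP.
rewrite !connection_formE (frame_derive_sum oU _ _ _ Uu); last first.
  by move=> k; exact: smoothM.
under [X in _ = _ + X]eq_bigr do rewrite !connection_formE.
rewrite -(frame_parseval (fun k => D b (E A k) u) (fun k => D a (E B k) u) Uu).
rewrite -big_split; apply: eq_bigr => k _ /=.
by rewrite (frame_deriveM _ _ _ _ Uu).
Qed.

(** Cartan's structure equation: the flat connection of R^n has no curvature. The
    coefficients al and be are those of the bracket of the two derivations. *)
Lemma structure_equation (al be : R) A B u : U u ->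
  (forall g, smooth_on U g -> D 0 (D 1 g) u - D 1 (D 0 g) u = al * D 0 g u + be * D 1 g u) ->
  D 0 (theta 1 A B) u - D 1 (theta 0 A B) u =
  al * theta 0 A B u + be * theta 1 A B u
  + \sum_C (theta 1 A C u * theta 0 B C u - theta 0 A C u * theta 1 B C u).
Proof.
move=> Uu comm; rewrite sumrB.
have := frame_second_derive 0 1 A B Uu; have := frame_second_derive 1 0 A B Uu.
move=> E1 E2.
have : \sum_k D 0 (D 1 (E A k)) u * E B k u - \sum_k D 1 (D 0 (E A k)) u * E B k u =
   al * theta 0 A B u + be * theta 1 A B u.
  rewrite -sumrB !connection_formE !mulr_sumr -big_split; apply: eq_bigr => k _ /=.
  by rewrite -mulrBl comm //; ring.
by rewrite E1 E2 => <-; ring.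
Qed.

End OrthonormalFrame.

(** * The equations of Gauss, Codazzi and Ricci, and the biharmonic equation *)

(** The vectors of the frame adapted to a surface of the sphere: i0 stands for the
    position vector, i1 and i2 for the tangent vectors, i3 for the normal xi in the
    direction of the mean curvature, i4 for the other normal eta. *)
Definition i0 : 'I_5 := @Ordinal 5 0 isT.
Definition i1 : 'I_5 := @Ordinal 5 1 isT.
Definition i2 : 'I_5 := @Ordinal 5 2 isT.
Definition i3 : 'I_5 := @Ordinal 5 3 isT.
Definition i4 : 'I_5 := @Ordinal 5 4 isT.

Lemma sum5 (A : nmodType) (F : 'I_5 -> A) :
  \sum_i F i = F i0 + F i1 + F i2 + F i3 + F i4.
Proof.
rewrite !big_ord_recl big_ord0 addr0 -!addrA.
by congr (F _ + (F _ + (F _ + (F _ + F _)))); exact: val_inj.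
Qed.

Lemma ord5_ind (P : 'I_5 -> Prop) : P i0 -> P i1 -> P i2 -> P i3 -> P i4 -> forall i, P i.
Proof.
move=> P0 P1 P2 P3 P4 i.
have E : i \in [:: i0; i1; i2; i3; i4] by case: i => [[|[|[|[|[|//]]]]] ?].
by move: E; rewrite !inE => /or4P[/eqP->|/eqP->|/eqP->|/orP[/eqP->|/eqP->]].
Qed.

Lemma ord2_ind (P : 'I_2 -> Prop) : P 0 -> P 1 -> forall i, P i.
Proof.
move=> P0 P1 i; have : (i == 0) || (i == 1) by case: i => [[|[|//]] ?].
by case/orP => /eqP ->.
Qed.

(** Let a_i = X_i - 2 p_i y and b_i = Y_i + 2 p_i x be the covariant derivatives of
    the traceless symmetric tensor with entries x, y, -x. The Codazzi equation says
    b_0 = a_1 and b_1 = - a_0, and the constancy of the norm says that (x, y) is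
    orthogonal to (a_0, b_0) and (a_1, b_1): a linear system in a_0, a_1 whose
    determinant is x^2 + y^2. *)
Lemma traceless_codazzi_solution (R : realFieldType) (p0 p1 x y X0 X1 Y0 Y1 : R) :
  x * X0 + y * Y0 = 0 -> x * X1 + y * Y1 = 0 ->
  Y0 - X1 = - (2 * p0 * x) - 2 * p1 * y -> - X0 - Y1 = - (2 * p0 * y) + 2 * p1 * x ->
  x * x + y * y != 0 ->
  [/\ X0 = 2 * p0 * y, X1 = 2 * p1 * y, Y0 = - (2 * p0 * x) & Y1 = - (2 * p1 * x)].
Proof.
move=> E0 E1 C1 C2 n0.
pose a := X0 - 2 * p0 * y; pose b := X1 - 2 * p1 * y.
have Y0E : Y0 = b - 2 * p0 * x by rewrite /b; lra.
have Y1E : Y1 = - a - 2 * p1 * x by rewrite /a; lra.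
have F0 : x * a + y * b = 0 by rewrite -E0 Y0E /a; ring.
have F1 : x * b - y * a = 0 by rewrite -E1 Y1E /b; ring.
have a0 : a = 0.
  apply: (mulfI n0); rewrite mulr0.
  have -> : (x * x + y * y) * a = x * (x * a + y * b) - y * (x * b - y * a) by ring.
  by rewrite F0 F1 !mulr0 subr0.
have b0 : b = 0.
  apply: (mulfI n0); rewrite mulr0.
  have -> : (x * x + y * y) * b = y * (x * a + y * b) + x * (x * b - y * a) by ring.
  by rewrite F0 F1 !mulr0 addr0.
by move: Y0E Y1E; rewrite a0 b0; split; [move: a0|move: b0| |]; rewrite /a /b; lra.
Qed.

Lemma open_nonzero (R : realType) (V : normedModType R) (U : set V) (f : V -> R) :
  open U -> smooth_on U f -> open [set v | U v /\ f v != 0].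
Proof.
move=> oU sf; rewrite openE => v [Uv fv].
have cf : {for v, continuous f} by exact/differentiable_continuous/smooth_diff.
have : \forall y \near f v, y != 0.
  by apply: open_nbhs_nbhs; split => //; exact: open_neq.
move=> /cf H; apply: filterI => //; exact: open_nbhs_nbhs.
Qed.

Section SurfaceInSphere.
Context {R : realType}.
Local Notation V := 'rV[R]_2.
Context (U : set V) (oU : open U) (m : 'I_2 -> 'I_2 -> V -> R).
Hypothesis sm : forall a i, smooth_on U (m a i).
Local Notation D := (frame_derive m).
Context (E : 'I_5 -> 'I_5 -> V -> R).
Hypothesis sE : forall A k, smooth_on U (E A k).
Hypothesis E_orth : forall A B u, U u -> \sum_k E A k u * E B k u = (A == B)%:R.
Local Notation theta := (connection_form m E).
Local Notation p0 := (theta 0 i1 i2).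
Local Notation p1 := (theta 1 i1 i2).
Local Notation b11 := (theta 0 i1 i3).
Local Notation b12 := (theta 0 i2 i3).
Local Notation b22 := (theta 1 i2 i3).
Local Notation c11 := (theta 0 i1 i4).
Local Notation c12 := (theta 0 i2 i4).
Local Notation c22 := (theta 1 i2 i4).
Local Notation w0 := (theta 0 i3 i4).
Local Notation w1 := (theta 1 i3 i4).
Hypothesis comm : forall g u, U u -> smooth_on U g ->
  D 0 (D 1 g) u - D 1 (D 0 g) u = - p0 u * D 0 g u + - p1 u * D 1 g u.
Hypothesis position : forall u, U u ->
  [/\ theta 0 i0 i1 u = 1, theta 0 i0 i2 u = 0,
      theta 1 i0 i1 u = 0 & theta 1 i0 i2 u = 1] /\
  [/\ theta 0 i0 i3 u = 0, theta 0 i0 i4 u = 0,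
      theta 1 i0 i3 u = 0 & theta 1 i0 i4 u = 0].
Context (h : R) (h_neq0 : h != 0).
Hypothesis trace_b : forall u, U u -> b11 u + b22 u = 2 * h.
Hypothesis trace_c : forall u, U u -> c11 u + c22 u = 0.
(* The bitension field of xi paired with E_C: in the frame, the trace of the second
   covariant derivative is sum_a (D_a D_a - D_(nabla_a e_a)), with
   nabla_1 e_1 = p0 e_2 and nabla_2 e_2 = - p1 e_1, and the curvature of the
   sphere contributes 2 xi. *)
Hypothesis biharmonic_frame : forall C u, U u -> C != i0 ->
  \sum_k D 0 (D 0 (E i3 k)) u * E C k u + \sum_k D 1 (D 1 (E i3 k)) u * E C k u
  - p0 u * theta 1 i3 C u + p1 u * theta 0 i3 C u + 2 * (C == i3)%:R = 0.

Let sth a A B : smooth_on U (theta a A B).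
Proof. exact: smooth_connection_form. Qed.

Let skew a A B u : U u -> theta a B A u = - theta a A B u.
Proof. exact: connection_form_skew. Qed.

Let diag a A u : U u -> theta a A A u = 0.
Proof. by move=> Uu; have := skew a A A Uu; lra. Qed.

Let structure A B u (Uu : U u) := structure_equation oU sm sE E_orth A B Uu
  (fun g => comm Uu (g := g)).

(* Rewriting rules that bring every entry of the connection form to one of the
   entries named above. *)
Let normalize u : U u ->
  ((forall a A, theta a A A u = 0) *
  (forall a, theta a i2 i1 u = - theta a i1 i2 u) *
  (forall a, theta a i3 i1 u = - theta a i1 i3 u) *
  (forall a, theta a i3 i2 u = - theta a i2 i3 u) *
  (forall a, theta a i4 i1 u = - theta a i1 i4 u) *
  (forall a, theta a i4 i2 u = - theta a i2 i4 u) *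
  (forall a, theta a i4 i3 u = - theta a i3 i4 u) *
  (theta 0 i0 i1 u = 1) * (theta 0 i0 i2 u = 0) *
  (theta 1 i0 i1 u = 0) * (theta 1 i0 i2 u = 1) *
  (theta 0 i1 i0 u = - 1) * (theta 0 i2 i0 u = 0) *
  (theta 1 i1 i0 u = 0) * (theta 1 i2 i0 u = - 1) *
  (forall a, theta a i0 i3 u = 0) * (forall a, theta a i0 i4 u = 0) *
  (forall a, theta a i3 i0 u = 0) * (forall a, theta a i4 i0 u = 0))%type.
Proof.
move=> Uu; have [[q1 q2 q3 q4] [q5 q6 q7 q8]] := position Uu.
have q03 a : theta a i0 i3 u = 0 by elim/ord2_ind: a.
have q04 a : theta a i0 i4 u = 0 by elim/ord2_ind: a.
by do ![split] => *; rewrite ?diag // skew // ?q1 ?q2 ?q3 ?q4 ?q03 ?q04 ?oppr0.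
Qed.

Let D_const (W : set V) a f (c : R) u : open W -> (forall u, W u -> f u = c) ->
  W u -> D a f u = 0.
Proof.
by move=> oW fc Wu; rewrite (frame_derive_ext m a oW fc Wu) frame_derive_cst.
Qed.

(* As the entries of theta(f, _) are constant, the structure equation of the pair
   (f, normal) reduces to the symmetry of the second fundamental form. *)
Let b21E u : U u -> theta 1 i1 i3 u = b12 u.
Proof.
move=> Uu; have := structure i0 i3 Uu.
rewrite (D_const _ oU (c := 0)) // => [|v Uv]; last by rewrite normalize.
rewrite (D_const _ oU (c := 0)) // => [|v Uv]; last by rewrite normalize.
by rewrite sum5 !(normalize Uu); lra.
Qed.

Let c21E u : U u -> theta 1 i1 i4 u = c12 u.
Proof.
move=> Uu; have := structure i0 i4 Uu.
rewrite (D_const _ oU (c := 0)) // => [|v Uv]; last by rewrite normalize.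
rewrite (D_const _ oU (c := 0)) // => [|v Uv]; last by rewrite normalize.
by rewrite sum5 !(normalize Uu); lra.
Qed.

Let Db21 a u : U u -> D a (theta 1 i1 i3) u = D a b12 u.
Proof. by move=> Uu; exact: (frame_derive_ext m a oU b21E Uu). Qed.

Let Dc21 a u : U u -> D a (theta 1 i1 i4) u = D a c12 u.
Proof. by move=> Uu; exact: (frame_derive_ext m a oU c21E Uu). Qed.

Let c22E u : U u -> c22 u = - c11 u.
Proof. by move=> Uu; have := trace_c Uu; lra. Qed.

Let Db22 a u : U u -> D a b22 u = - D a b11 u.
Proof.
move=> Uu; apply/eqP; rewrite -addr_eq0 addrC -(frame_deriveD m a (sth _ _ _) (sth _ _ _) Uu).
by apply/eqP; exact: D_const oU trace_b Uu.
Qed.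

Lemma gauss_equation u : U u ->
  D 0 p1 u - D 1 p0 u = - p0 u ^+ 2 - p1 u ^+ 2 - 1
    - (b11 u * b22 u - b12 u ^+ 2) - (c11 u * c22 u - c12 u ^+ 2).
Proof.
move=> Uu; rewrite (structure i1 i2 Uu) sum5 !(normalize Uu) ?b21E // ?c21E //.
by ring.
Qed.

Lemma codazzi_b1 u : U u -> D 0 b12 u - D 1 b11 u =
  - p0 u * (b11 u - b22 u) - 2 * p1 u * b12 u + c12 u * w0 u - c11 u * w1 u.
Proof.
move=> Uu; rewrite -Db21 // (structure i1 i3 Uu) sum5 !(normalize Uu) ?b21E // ?c21E //.
by ring.
Qed.

Lemma codazzi_b2 u : U u -> - D 0 b11 u - D 1 b12 u =
  - 2 * p0 u * b12 u + p1 u * (b11 u - b22 u) + c22 u * w0 u - c12 u * w1 u.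
Proof.
move=> Uu; rewrite -Db22 // (structure i2 i3 Uu) sum5 !(normalize Uu) ?b21E // ?c21E //.
by ring.
Qed.

Lemma codazzi_c1 u : U u -> D 0 c12 u - D 1 c11 u =
  - p0 u * (c11 u - c22 u) - 2 * p1 u * c12 u - b12 u * w0 u + b11 u * w1 u.
Proof.
move=> Uu; rewrite -Dc21 // (structure i1 i4 Uu) sum5 !(normalize Uu) ?b21E // ?c21E //.
by ring.
Qed.

Lemma codazzi_c2 u : U u -> D 0 c22 u - D 1 c12 u =
  - 2 * p0 u * c12 u + p1 u * (c11 u - c22 u) - b22 u * w0 u + b12 u * w1 u.
Proof.
move=> Uu; rewrite (structure i2 i4 Uu) sum5 !(normalize Uu) ?b21E // ?c21E //.
by ring.
Qed.

Lemma ricci_equation u : U u -> D 0 w1 u - D 1 w0 u =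
  - p0 u * w0 u - p1 u * w1 u
  + b12 u * c11 u + b22 u * c12 u - b11 u * c12 u - b12 u * c22 u.
Proof.
move=> Uu; rewrite (structure i3 i4 Uu) sum5 !(normalize Uu) ?b21E // ?c21E //.
by ring.
Qed.

Let biharmonic_components C u : U u -> C != i0 ->
  D 0 (theta 0 i3 C) u + D 1 (theta 1 i3 C) u
  - \sum_B theta 0 i3 B u * theta 0 C B u - \sum_B theta 1 i3 B u * theta 1 C B u
  - p0 u * theta 1 i3 C u + p1 u * theta 0 i3 C u + 2 * (C == i3)%:R = 0.
Proof.
move=> Uu C0; have := biharmonic_frame Uu C0.
rewrite !(frame_second_derive oU sm sE E_orth _ _ _ _ Uu) => H.
rewrite -[RHS]H; ring.
Qed.

Let D_opp a A B u : U u -> D a (theta a B A) u = - D a (theta a A B) u.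
Proof.
move=> Uu; rewrite -(frame_deriveN m a (sth _ _ _) Uu).
by apply: (frame_derive_ext m a oU) => // v Uv; exact: skew.
Qed.

(** The divergence of b occurs twice, once in the tangential part of the
    biharmonic equation and once as the trace of the Codazzi equation where
    tr b = 2h; eliminating it leaves c applied to w. *)
Lemma tangential_biharmonic u : U u ->
  c11 u * w0 u + c12 u * w1 u = 0 /\ c12 u * w0 u - c11 u * w1 u = 0.
Proof.
move=> Uu; split.
  have := @biharmonic_components i1 u Uu isT.
  rewrite (_ : (i1 == i3) = false) // mulr0 (D_opp 0 i1 i3 Uu) (D_opp 1 i1 i3 Uu).
  rewrite Db21 // !sum5 !(normalize Uu) ?b21E // ?c21E //.
  by have := codazzi_b2 Uu; rewrite !(c22E Uu); lra.
have := @biharmonic_components i2 u Uu isT.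
rewrite (_ : (i2 == i3) = false) // mulr0 (D_opp 0 i2 i3 Uu) (D_opp 1 i2 i3 Uu).
rewrite Db22 // !sum5 !(normalize Uu) ?b21E // ?c21E //.
by have := codazzi_b1 Uu; rewrite !(c22E Uu); lra.
Qed.

Lemma normal_biharmonic_xi u : U u ->
  b11 u ^+ 2 + 2 * b12 u ^+ 2 + b22 u ^+ 2 + w0 u ^+ 2 + w1 u ^+ 2 = 2.
Proof.
move=> Uu; have := @biharmonic_components i3 u Uu isT.
rewrite (D_const _ oU (c := 0)) // => [|v Uv]; last by rewrite normalize.
rewrite (D_const _ oU (c := 0)) // => [|v Uv]; last by rewrite normalize.
rewrite !sum5 !(normalize Uu) ?b21E // (_ : (i3 == i3)%:R = 1) ?eqxx // => H.
by lra.
Qed.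

(** Where w vanishes identically, so does its divergence, and only <b, c> is
    left in the eta component. *)
Lemma normal_biharmonic_eta u : (forall u, U u -> w0 u = 0 /\ w1 u = 0) -> U u ->
  b11 u * c11 u + 2 * b12 u * c12 u + b22 u * c22 u = 0.
Proof.
move=> w0E Uu; have := @biharmonic_components i4 u Uu isT.
rewrite (D_const _ oU (c := 0)) // => [|v Uv]; last by have [] := w0E v Uv.
rewrite (D_const _ oU (c := 0)) // => [|v Uv]; last by have [] := w0E v Uv.
rewrite !sum5 !(normalize Uu) ?b21E // ?c21E //.
rewrite (_ : (i4 == i3)%:R = 0) //; have [-> ->] := w0E u Uu => H; lra.
Qed.

Section ParallelShape.
Context (W : set V) (oW : open W) (WU : W `<=` U).
Hypothesis c0 : forall u, W u -> [/\ c11 u = 0, c12 u = 0 & c22 u = 0].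
Context (d : R) (d_h : d != h ^+ 2) (d_1 : 1 + d != 0).
Hypothesis det_b : forall u, W u -> b11 u * b22 u - b12 u ^+ 2 = d.

(* x and b12 are the entries of the traceless part of b. *)
Let x u := b11 u - h.

Let sx : smooth_on U x.
Proof. by apply: smoothB => //; exact: smooth_cst. Qed.

Let b11x u : b11 u = h + x u.
Proof. by rewrite /x; ring. Qed.

Let Dx a u : U u -> D a x u = D a b11 u.
Proof.
move=> Uu; rewrite (frame_deriveB oU m a (sth _ _ _) _ Uu); last exact: smooth_cst.
by rewrite frame_derive_cst subr0.
Qed.

Let b22x u : U u -> b22 u = h - x u.
Proof. by move=> Uu; have := trace_b Uu; rewrite /x; lra. Qed.

Let xx_yy u : W u -> x u * x u + b12 u * b12 u = h ^+ 2 - d.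
Proof. by move=> Wu; rewrite -(det_b Wu) b11x b22x; [ring|exact: WU]. Qed.

Let traceless_gradient u : W u ->
  [/\ D 0 x u = 2 * p0 u * b12 u, D 1 x u = 2 * p1 u * b12 u,
      D 0 b12 u = - (2 * p0 u * x u) & D 1 b12 u = - (2 * p1 u * x u)].
Proof.
move=> Wu; have Uu := WU Wu; have [z11 z12 z22] := c0 Wu.
have orth a : x u * D a x u + b12 u * D a b12 u = 0.
  have := D_const a oW xx_yy Wu.
  by rewrite (frame_deriveD m a _ _ Uu) ?(frame_deriveM m a _ _ Uu) //;
    try exact: smoothM; lra.
apply: traceless_codazzi_solution => //.
- by have := codazzi_b1 Uu; rewrite z11 z12 b11x (b22x Uu) -Dx //; lra.
- by have := codazzi_b2 Uu; rewrite z12 z22 b11x (b22x Uu) -Dx //; lra.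
- by rewrite (xx_yy Wu) subr_eq0 eq_sym.
Qed.

(** The traceless part (x, y) of b satisfies D_a x = 2 p_a y and D_a y = - 2 p_a x.
    Applying to x and to y the commutator of the derivations shows that the Gauss
    curvature, here 1 + d, annihilates both; but x^2 + y^2 = h^2 - d <> 0. *)
Lemma no_parallel_shape u : ~ W u.
Proof.
move=> Wu; have Uu := WU Wu.
have sp a : smooth_on U (theta a i1 i2) by [].
have two : smooth_on U (fun=> 2 : R) by exact: smooth_cst.
have DX a b v : W v -> D a (D b x) v =
    2 * (D a (theta b i1 i2) v * b12 v + theta b i1 i2 v * D a b12 v).
  move=> Wv; have Uv := WU Wv.
  rewrite (frame_derive_ext m a oW (g := fun v => 2 * (theta b i1 i2 v * b12 v)) _ Wv).
    rewrite (frame_deriveM m a two (smoothM oU (sp b) (sth _ _ _)) Uv).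
    by rewrite frame_derive_cst (frame_deriveM m a (sp b) (sth _ _ _) Uv); ring.
  by move=> z Wz; have [+ + _ _] := traceless_gradient Wz; elim/ord2_ind: b => [-> _|_ ->]; ring.
have DY a b v : W v -> D a (D b b12) v =
    - 2 * (D a (theta b i1 i2) v * x v + theta b i1 i2 v * D a x v).
  move=> Wv; have Uv := WU Wv.
  rewrite (frame_derive_ext m a oW (g := fun v => 2 * (theta b i1 i2 v * - x v)) _ Wv).
    have snx : smooth_on U (fun v => - x v) by exact: smoothN.
    rewrite (frame_deriveM m a two (smoothM oU (sp b) snx) Uv).
    rewrite frame_derive_cst (frame_deriveM m a (sp b) snx Uv).
    by rewrite (frame_deriveN m a sx Uv); ring.
  by move=> z Wz; have [_ _] := traceless_gradient Wz; elim/ord2_ind: b => [-> _|_ ->]; ring.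
have [X0 X1 Y0 Y1] := traceless_gradient Wu.
have := comm Uu sx; have := comm Uu (sth 0 i2 i3).
rewrite !DX // !DY // X0 X1 Y0 Y1 => E1 E2.
have K := gauss_equation Uu; have [z11 z12 z22] := c0 Wu.
move: K; rewrite (det_b Wu) z11 z12 => K.
have Kd : D 0 p1 u = D 1 p0 u - p0 u ^+ 2 - p1 u ^+ 2 - 1 - d by lra.
move: E1 E2; rewrite Kd => E1 E2.
have y0 : b12 u = 0 by apply: (mulfI d_1); lra.
have x0 : x u = 0 by apply: (mulfI d_1); lra.
have := xx_yy Wu; rewrite x0 y0 !mulr0 addr0 => /esym/eqP.
by rewrite subr_eq0 eq_sym; exact/negP.
Qed.

End ParallelShape.

(** On the open set where w <> 0 one has c = 0, and the Codazzi equation for c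
    says that w is proportional to both rows of b, so that det b = 0. *)
Lemma normal_connection_flat u : U u -> w0 u = 0 /\ w1 u = 0.
Proof.
move=> Uu; pose q v := w0 v * w0 v + w1 v * w1 v.
have sq : smooth_on U q by apply: smoothD => //; exact: smoothM.
have [q0|qu] := eqVneq (q u) 0.
  have w00 : w0 u * w0 u = 0.
    by apply/eqP; rewrite eq_le -expr2 sqr_ge0 andbT -q0 /q -!expr2 lerDl sqr_ge0.
  move: q0; rewrite /q w00 add0r => /eqP; rewrite mulf_eq0 orbb => /eqP ->.
  by move/eqP: w00; rewrite mulf_eq0 orbb => /eqP ->.
pose W := [set v | U v /\ q v != 0].
have oW : open W by exact: open_nonzero.
have WU : W `<=` U by move=> v [].
have c0 v : W v -> [/\ c11 v = 0, c12 v = 0 & c22 v = 0].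
  move=> [Uv qv]; have [T1 T2] := tangential_biharmonic Uv.
  have z11 : c11 v = 0.
    apply: (mulfI qv); rewrite mulr0 /q.
    have -> : (w0 v * w0 v + w1 v * w1 v) * c11 v =
      w0 v * (c11 v * w0 v + c12 v * w1 v) - w1 v * (c12 v * w0 v - c11 v * w1 v) by ring.
    by rewrite T1 T2 !mulr0 subr0.
  have z12 : c12 v = 0.
    apply: (mulfI qv); rewrite mulr0 /q.
    have -> : (w0 v * w0 v + w1 v * w1 v) * c12 v =
      w1 v * (c11 v * w0 v + c12 v * w1 v) + w0 v * (c12 v * w0 v - c11 v * w1 v) by ring.
    by rewrite T1 T2 !mulr0 addr0.
  by split => //; rewrite c22E // z11 oppr0.
have c0' v : W v -> (c11 v = 0) * (c12 v = 0) * (c22 v = 0) by move=> /c0 [].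
have det0 v : W v -> b11 v * b22 v - b12 v ^+ 2 = 0.
  move=> Wv; have [Uv qv] := Wv.
  have := codazzi_c1 Uv; have := codazzi_c2 Uv.
  have Dc a f : (forall v, W v -> f v = 0) -> D a f v = 0.
    by move=> f0; exact: D_const oW f0 Wv.
  rewrite !(Dc _ c11) ?(Dc _ c12) ?(Dc _ c22); do ?[by move=> z /c0'->].
  rewrite !(c0' _ Wv) => E2 E1.
  apply: (mulfI qv); rewrite mulr0 /q.
  have -> : (w0 v * w0 v + w1 v * w1 v) * (b11 v * b22 v - b12 v ^+ 2) =
    (b11 v * w0 v + b12 v * w1 v) * (b22 v * w0 v - b12 v * w1 v)
    + (b12 v * w0 v + b22 v * w1 v) * (b11 v * w1 v - b12 v * w0 v) by ring.
  have -> : b22 v * w0 v - b12 v * w1 v = 0 by lra.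
  have -> : b11 v * w1 v - b12 v * w0 v = 0 by lra.
  by rewrite !mulr0 addr0.
exfalso; apply: (no_parallel_shape oW WU c0 (d := 0) _ _ det0 (conj Uu qu)).
- by rewrite eq_sym expf_eq0.
- by rewrite addr0 oner_eq0.
Qed.

(** With w = 0 the norm and the trace of b fix its determinant 2h^2 - 1. If h^2 is
    not 1, the traceless part of b vanishes nowhere; c is both proportional to it
    (Ricci) and orthogonal to it, so c = 0, which no_parallel_shape excludes. *)
Theorem umbilical_along_mean_curvature u : U u ->
  h ^+ 2 = 1 /\ [/\ b11 u = h, b12 u = 0, b22 u = h & theta 1 i1 i3 u = 0].
Proof.
move=> Uu.
have norm_b v : U v -> b11 v ^+ 2 + 2 * b12 v ^+ 2 + b22 v ^+ 2 = 2.
  move=> Uv; have := normal_biharmonic_xi Uv.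
  by have [-> ->] := normal_connection_flat Uv; lra.
have b22h v : U v -> b22 v = 2 * h - b11 v by move=> Uv; have := trace_b Uv; lra.
have [h1|h1] := eqVneq (h ^+ 2) 1.
  split => //; have Nb := norm_b _ Uu; have bh := b22h _ Uu.
  have xy : (b11 u - h) ^+ 2 + b12 u ^+ 2 = 0.
    have : 2 * ((b11 u - h) ^+ 2 + b12 u ^+ 2) =
       (b11 u ^+ 2 + 2 * b12 u ^+ 2 + b22 u ^+ 2) - 2 * h ^+ 2 by rewrite bh; ring.
    by rewrite Nb h1; lra.
  have /andP[/eqP x0 /eqP y0] : ((b11 u - h) == 0) && (b12 u == 0).
    by move/eqP: xy; rewrite paddr_eq0 ?sqr_ge0 // !sqrf_eq0.
  by rewrite b21E // y0; split => //; lra.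
have xy v : U v -> (b11 v - h) * (b11 v - h) + b12 v * b12 v = 1 - h ^+ 2.
  by move=> Uv; have := norm_b _ Uv; rewrite (b22h _ Uv); lra.
have c0 v : U v -> [/\ c11 v = 0, c12 v = 0 & c22 v = 0].
  move=> Uv; have eta := normal_biharmonic_eta normal_connection_flat Uv.
  have := ricci_equation Uv.
  rewrite !(D_const _ oU (c := 0) _ Uv); do ?[by move=> z /normal_connection_flat[]].
  move: eta; have [-> ->] := normal_connection_flat Uv; rewrite !(c22E Uv) !(b22h _ Uv).
  move=> eta ricci.
  have n0 : (b11 v - h) * (b11 v - h) + b12 v * b12 v != 0.
    by rewrite xy // subr_eq0 eq_sym.
  have F1 : (b11 v - h) * c11 v + b12 v * c12 v = 0 by lra.
  have F2 : b12 v * c11 v - (b11 v - h) * c12 v = 0 by lra.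
  have z11 : c11 v = 0.
    apply: (mulfI n0); rewrite mulr0.
    have -> : ((b11 v - h) * (b11 v - h) + b12 v * b12 v) * c11 v =
      (b11 v - h) * ((b11 v - h) * c11 v + b12 v * c12 v)
      + b12 v * (b12 v * c11 v - (b11 v - h) * c12 v) by ring.
    by rewrite F1 F2 !mulr0 addr0.
  have z12 : c12 v = 0.
    apply: (mulfI n0); rewrite mulr0.
    have -> : ((b11 v - h) * (b11 v - h) + b12 v * b12 v) * c12 v =
      b12 v * ((b11 v - h) * c11 v + b12 v * c12 v)
      - (b11 v - h) * (b12 v * c11 v - (b11 v - h) * c12 v) by ring.
    by rewrite F1 F2 !mulr0 subr0.
  by rewrite z11 oppr0.
exfalso; apply: (no_parallel_shape oU (fun v Uv => Uv) c0 (d := 2 * h ^+ 2 - 1) _ _ _ Uu).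
- by apply: contra h1 => /eqP H; apply/eqP; lra.
- by rewrite addrC subrK mulf_neq0 ?expf_neq0 // pnatr_eq0.
- by move=> v Uv; have := norm_b _ Uv; rewrite (b22h _ Uv); lra.
Qed.

End SurfaceInSphere.

(** * The tangent frame *)

HB.lock Definition gram (R : realType) (N : nat) (phi : 'I_N -> 'rV[R]_2 -> R)
    (i j : 'I_2) (u : 'rV[R]_2) : R :=
  \sum_k pder i (phi k) u * pder j (phi k) u.

Section GramSchmidt.
Context {R : realType}.
Local Notation V := 'rV[R]_2.
Context (U : set V) (oU : open U) (N : nat) (phi : 'I_N -> V -> R).
Hypothesis sphi : forall k, smooth_on U (phi k).

Local Notation gram := (gram phi).

Lemma gramE i j : gram i j =
  fun u => \sum_k pder i (phi k) u * pder j (phi k) u.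
Proof. by rewrite gram.unlock. Qed.

(** The orthonormalization of the coordinate frame: the rows are
    d_0 / |d_0| and (g_00 d_1 - g_01 d_0) / sqrt (g_00 det g). *)
Definition gram_schmidt (a i : 'I_2) (u : V) : R :=
  let s := (Num.sqrt (gram 0 0 u * (gram 0 0 u * gram 1 1 u - gram 0 1 u * gram 0 1 u)))^-1 in
  if a == 0 then (if i == 0 then (Num.sqrt (gram 0 0 u))^-1 else 0)
  else if i == 0 then - gram 0 1 u * s else gram 0 0 u * s.

Hypothesis indep : forall u, U u -> forall a b : R,
  (forall k, a * pder 0 (phi k) u + b * pder 1 (phi k) u = 0) -> a = 0 /\ b = 0.

Let sgram i j : smooth_on U (gram i j).
Proof.
by rewrite gramE; apply: smooth_sum => // k; apply: smoothM => //; exact: smooth_pder.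
Qed.

Lemma gramC i j u : gram i j u = gram j i u.
Proof. by rewrite !gramE; apply: eq_bigr => k _; rewrite mulrC. Qed.

Lemma sum_sqr_gt0 n (x : 'I_n -> R) : (exists k, x k != 0) -> 0 < \sum_k x k * x k.
Proof.
move=> [k xk]; rewrite (bigD1 k) //= ltr_pwDl //; last first.
  by apply: sumr_ge0 => j _; rewrite -expr2 sqr_ge0.
by rewrite -expr2 exprn_even_gt0.
Qed.

Let combination_gt0 u (a b : R) : U u -> ~ (a = 0 /\ b = 0) ->
  0 < a * a * gram 0 0 u + 2 * a * b * gram 0 1 u + b * b * gram 1 1 u.
Proof.
move=> Uu ab; have -> : a * a * gram 0 0 u + 2 * a * b * gram 0 1 u + b * b * gram 1 1 u =
  \sum_k (a * pder 0 (phi k) u + b * pder 1 (phi k) u) *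
         (a * pder 0 (phi k) u + b * pder 1 (phi k) u).
  rewrite !gramE !mulr_sumr -!big_split; apply: eq_bigr => k _ /=.
  by ring.
apply: sum_sqr_gt0; apply: contrapT => /forallNP H; apply: ab; apply: (indep Uu) => k.
by apply/eqP/negPn/negP => ?; exact: (H k).
Qed.

Let gram00_gt0 u : U u -> 0 < gram 0 0 u.
Proof.
move=> Uu; have := @combination_gt0 u 1 0 Uu; rewrite !mulr0 !mul0r !addr0 !mul1r; apply.
by case => /eqP; rewrite oner_eq0.
Qed.

Let gram_det_gt0 u : U u ->
  0 < gram 0 0 u * (gram 0 0 u * gram 1 1 u - gram 0 1 u * gram 0 1 u).
Proof.
move=> Uu; have := @combination_gt0 u (- gram 0 1 u) (gram 0 0 u) Uu.
have g0 := gram00_gt0 Uu.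
rewrite (_ : _ + _ = gram 0 0 u * (gram 0 0 u * gram 1 1 u - gram 0 1 u * gram 0 1 u)).
  by apply => -[_ /eqP]; rewrite gt_eqF.
ring.
Qed.

Lemma smooth_gram_schmidt a i : smooth_on U (gram_schmidt a i).
Proof.
have sr : smooth_on U (fun u => (Num.sqrt (gram 0 0 u))^-1) by exact: smooth_rsqrt.
have ss : smooth_on U (fun u => (Num.sqrt (gram 0 0 u *
    (gram 0 0 u * gram 1 1 u - gram 0 1 u * gram 0 1 u)))^-1).
  apply: smooth_rsqrt => //; apply: smoothM => //; apply: smoothB => //; exact: smoothM.
rewrite /gram_schmidt; elim/ord2_ind: a; elim/ord2_ind: i => //=.
- exact: smooth_cst.
- by apply: smoothM => //; exact: smoothN.
- exact: smoothM.
Qed.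

Lemma gram_schmidt_orthonormal a b u : U u ->
  \sum_i \sum_j gram_schmidt a i u * gram_schmidt b j u * gram i j u = (a == b)%:R.
Proof.
move=> Uu; rewrite sum2 !sum2 /gram_schmidt (gramC 1 0).
have := rsqrtP (gram00_gt0 Uu); have := rsqrtP (gram_det_gt0 Uu).
move: (_^-1) (_^-1) => s r Hs Hr.
elim/ord2_ind: a; elim/ord2_ind: b; rewrite /=.
- by rewrite -[RHS]Hr; ring.
- by rewrite -[RHS](mulr0 0); ring.
- by rewrite -[RHS](mulr0 0); ring.
- by rewrite -[RHS]Hs; ring.
Qed.

End GramSchmidt.

Section TangentFrame.
Context {R : realType}.
Local Notation V := 'rV[R]_2.
Context (U : set V) (oU : open U) (N : nat) (phi : 'I_N -> V -> R).
Hypothesis sphi : forall k, smooth_on U (phi k).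
Context (m : 'I_2 -> 'I_2 -> V -> R).
Hypothesis sm : forall a i, smooth_on U (m a i).
Hypothesis orthonormal : forall a b u, U u ->
  \sum_i \sum_j m a i u * m b j u * gram phi i j u = (a == b)%:R.
Local Notation D := (frame_derive m).
Local Notation e a k := (D a (phi k)).

Let se a k : smooth_on U (e a k).
Proof. exact: smooth_frame_derive. Qed.

Lemma tangent_frame_orthonormal a b u : U u -> \sum_k e a k u * e b k u = (a == b)%:R.
Proof.
move=> Uu; rewrite -(orthonormal a b Uu) !sum2 !gramE !mulr_sumr -!big_split /=.
by apply: eq_bigr => k _; rewrite !frame_deriveE !sum2; ring.
Qed.

Definition frame_component (i a : 'I_2) (u : V) : R := \sum_k pder i (phi k) u * e a k u.
Local Notation fe := frame_component.

Lemma frame_componentE i a u : fe i a u = \sum_l m a l u * gram phi l i u.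
Proof.
rewrite /fe sum2 !gramE !mulr_sumr -big_split /=.
by apply: eq_bigr => k _; rewrite !frame_deriveE !sum2; ring.
Qed.

Let Mm u : 'M[R]_2 := \matrix_(a, i) m a i u.
Let Gm u : 'M[R]_2 := \matrix_(i, j) gram phi i j u.

Let mgm u : U u -> Mm u *m Gm u *m (Mm u)^T = 1%:M.
Proof.
move=> Uu; apply/matrixP => a b; rewrite !mxE -(orthonormal a b Uu).
rewrite exchange_big; apply: eq_bigr => j _ /=; rewrite !mxE mulr_suml.
by apply: eq_bigr => i _; rewrite !mxE; ring.
Qed.

(** m g m^T = 1 also reads m^T (m g) = 1. *)
Lemma frame_dual i j u : U u -> \sum_a m a i u * fe j a u = (i == j)%:R.
Proof.
move=> Uu; have /matrixP /(_ i j) := mulmx1C (mgm Uu); rewrite !mxE => <-.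
apply: eq_bigr => a _; rewrite !mxE frame_componentE; congr (_ * _).
by apply: eq_bigr => l _; rewrite !mxE.
Qed.

Lemma inverse_gram i j u : U u ->
  invmx (\matrix_(i, j) gram phi i j u) i j = \sum_a m a i u * m a j u.
Proof.
move=> Uu; have E := mulmx1C (mgm Uu); rewrite mulmxA in E.
have GU : Gm u \in unitmx by have /mulmx1_unit[] := E.
have -> : invmx (\matrix_(i, j) gram phi i j u) = (Mm u)^T *m Mm u.
  by rewrite -[RHS](mulmxK GU) E mul1mx.
by rewrite !mxE; apply: eq_bigr => a _; rewrite !mxE.
Qed.

Lemma pder_frame i g u : U u -> pder i g u = \sum_a fe i a u * D a g u.
Proof.
move=> Uu; rewrite sum2 !frame_deriveE !sum2.
have E j := frame_dual j i Uu.
have -> : fe i 0 u * (m 0 0 u * pder 0 g u + m 0 1 u * pder 1 g u) +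
  fe i 1 u * (m 1 0 u * pder 0 g u + m 1 1 u * pder 1 g u) =
  (\sum_a m a 0 u * fe i a u) * pder 0 g u + (\sum_a m a 1 u * fe i a u) * pder 1 g u.
  by rewrite !sum2; ring.
by rewrite !E; elim/ord2_ind: i E => _ /=; ring.
Qed.

Lemma frame_derive2 a b g u : smooth_on U g -> U u ->
  D a (D b g) u = \sum_j D a (m b j) u * pder j g u
    + \sum_i \sum_j m a i u * m b j u * pder i (pder j g) u.
Proof.
move=> sg Uu; rewrite [D b g]frame_deriveE.
have sp j : smooth_on U (pder j g) by exact: smooth_pder.
rewrite (frame_derive_sum oU m a (fun j => smoothM oU (sm b j) (sp j)) Uu) !sum2.
rewrite !(frame_deriveM m a (sm _ _) (sp _) Uu) ![D a (pder _ g)]frame_deriveE !sum2.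
by ring.
Qed.

Local Notation p a u := (\sum_k D a (e 0 k) u * e 1 k u).

Lemma tangent_frame_skew a b c u : U u ->
  \sum_k D a (e b k) u * e c k u = - \sum_k D a (e c k) u * e b k u.
Proof.
move=> Uu; apply/eqP; rewrite -addr_eq0 -big_split /=; apply/eqP.
have D0 : D a (fun u => \sum_k e b k u * e c k u) u = 0.
  rewrite (frame_derive_ext m a oU (g := fun=> (b == c)%:R) _ Uu) ?frame_derive_cst //.
  by move=> v Uv; exact: tangent_frame_orthonormal.
rewrite -[RHS]D0 (frame_derive_sum oU _ _ _ Uu) => [|k]; last exact: smoothM.
by apply: eq_bigr => k _; rewrite (frame_deriveM m a (se b k) (se c k) Uu); ring.
Qed.

Let orthog a b u : U u -> \sum_k D a (e b k) u * e b k u = 0.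
Proof. by move=> Uu; have := tangent_frame_skew a b b Uu; lra. Qed.

(** The bracket of the two fields is - p_0 e_0 - p_1 e_1: applied to the
    coordinate functions phi it gives a tangent vector, whose components on e_0 and
    e_1 are those of D_0 e_1 - D_1 e_0. *)
Lemma frame_bracket l u : U u ->
  D 0 (m 1 l) u - D 1 (m 0 l) u = - p 0 u * m 0 l u + - p 1 u * m 1 l u.
Proof.
move=> Uu; pose ga j := D 0 (m 1 j) u - D 1 (m 0 j) u.
have E c : \sum_j ga j * fe j c u = \sum_k D 0 (e 1 k) u * e c k u - \sum_k D 1 (e 0 k) u * e c k u.
  rewrite -sumrB sum2 /fe !mulr_sumr -big_split /=; apply: eq_bigr => k _.
  rewrite !frame_derive2 // !sum2 (pderC oU 1 0 (sphi k) Uu) /ga.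
  by ring.
have -> : D 0 (m 1 l) u - D 1 (m 0 l) u =
    \sum_j ga j * (\sum_a m a l u * fe j a u).
  rewrite sum2 !(frame_dual _ _ Uu) /ga; elim/ord2_ind: l => /=; ring.
have -> : \sum_j ga j * (\sum_a m a l u * fe j a u) =
   m 0 l u * (\sum_j ga j * fe j 0 u) + m 1 l u * (\sum_j ga j * fe j 1 u).
  by rewrite !sum2; ring.
rewrite !E !orthog // (tangent_frame_skew 0 1 0 Uu); ring.
Qed.

Lemma frame_commutator g u : smooth_on U g -> U u ->
  D 0 (D 1 g) u - D 1 (D 0 g) u = - p 0 u * D 0 g u + - p 1 u * D 1 g u.
Proof.
move=> sg Uu; rewrite !frame_derive2 // ![D _ g]frame_deriveE !sum2.
rewrite (pderC oU 1 0 sg Uu).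
have := frame_bracket 0 Uu; have := frame_bracket 1 Uu => E1 E0.
have -> : D 0 (m 1 0) u = D 1 (m 0 0) u + (- p 0 u * m 0 0 u + - p 1 u * m 1 0 u) by lra.
have -> : D 0 (m 1 1) u = D 1 (m 0 1) u + (- p 0 u * m 0 1 u + - p 1 u * m 1 1 u) by lra.
ring.
Qed.

Definition hessian_component (i j a : 'I_2) (u : V) : R :=
  \sum_k pder i (pder j (phi k)) u * e a k u.
Local Notation he := hessian_component.

(** The Christoffel symbols, through the tangential part of d_i d_j phi. *)
Definition levi_civita (l i j : 'I_2) (u : V) : R := \sum_c m c l u * he i j c u.

(** The tangential part of sum_a D_a e_a, expanded in two ways: in the orthonormal
    frame, and in coordinates through the Christoffel symbols. *)
Lemma frame_divergence l u : U u ->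
  \sum_a D a (m a l) u + \sum_i \sum_j (\sum_a m a i u * m a j u) * levi_civita l i j u
  = p 0 u * m 1 l u - p 1 u * m 0 l u.
Proof.
move=> Uu; pose ga j := \sum_a D a (m a j) u.
have E c : \sum_j ga j * fe j c u + \sum_i \sum_j (\sum_a m a i u * m a j u) * he i j c u
    = \sum_k D 0 (e 0 k) u * e c k u + \sum_k D 1 (e 1 k) u * e c k u.
  rewrite -big_split !sum2 /fe /he !mulr_sumr -!big_split /=; apply: eq_bigr => k _.
  by rewrite !frame_derive2 // !sum2 /ga !sum2; ring.
have -> : \sum_a D a (m a l) u = \sum_j ga j * (\sum_a m a l u * fe j a u).
  rewrite [RHS]sum2 !(frame_dual _ _ Uu) /ga; elim/ord2_ind: l => /=; ring.
have -> : \sum_j ga j * (\sum_a m a l u * fe j a u) +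
    \sum_i \sum_j (\sum_a m a i u * m a j u) * levi_civita l i j u =
   m 0 l u * (\sum_j ga j * fe j 0 u
     + \sum_i \sum_j (\sum_a m a i u * m a j u) * he i j 0 u) +
   m 1 l u * (\sum_j ga j * fe j 1 u
     + \sum_i \sum_j (\sum_a m a i u * m a j u) * he i j 1 u).
  by rewrite /levi_civita !sum2; ring.
rewrite !E !orthog // (tangent_frame_skew 1 1 0 Uu); ring.
Qed.

(** The first-order terms of the two expressions of the Laplacian agree by
    frame_divergence. *)
Lemma frame_laplacian g u : smooth_on U g -> U u ->
  \sum_i \sum_j (\sum_a m a i u * m a j u) *
    (pder i (pder j g) u - \sum_l levi_civita l i j u * pder l g u) =
  D 0 (D 0 g) u + D 1 (D 1 g) u - p 0 u * D 1 g u + p 1 u * D 0 g u.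
Proof.
move=> sg Uu; have E0 := frame_divergence 0 Uu; have E1 := frame_divergence 1 Uu.
rewrite !frame_derive2 // ![D _ g]frame_deriveE !sum2.
move: E0 E1; rewrite !sum2 => E0 E1.
have -> : D 0 (m 0 0) u = p 0 u * m 1 0 u - p 1 u * m 0 0 u - D 1 (m 1 0) u
  - ((m 0 0 u * m 0 0 u + m 1 0 u * m 1 0 u) * levi_civita 0 0 0 u +
     (m 0 0 u * m 0 1 u + m 1 0 u * m 1 1 u) * levi_civita 0 0 1 u +
     ((m 0 1 u * m 0 0 u + m 1 1 u * m 1 0 u) * levi_civita 0 1 0 u +
      (m 0 1 u * m 0 1 u + m 1 1 u * m 1 1 u) * levi_civita 0 1 1 u)) by lra.
have -> : D 0 (m 0 1) u = p 0 u * m 1 1 u - p 1 u * m 0 1 u - D 1 (m 1 1) u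
  - ((m 0 0 u * m 0 0 u + m 1 0 u * m 1 0 u) * levi_civita 1 0 0 u +
     (m 0 0 u * m 0 1 u + m 1 0 u * m 1 1 u) * levi_civita 1 0 1 u +
     ((m 0 1 u * m 0 0 u + m 1 1 u * m 1 0 u) * levi_civita 1 1 0 u +
      (m 0 1 u * m 0 1 u + m 1 1 u * m 1 1 u) * levi_civita 1 1 1 u)) by lra.
ring.
Qed.

End TangentFrame.

(** * Completing an orthonormal family by a cross product *)

Section CrossProduct.
Context {R : realType} (n : nat).
Implicit Types (r : 'I_n.+1 -> 'I_n.+1 -> R) (x : 'I_n.+1 -> R).

(** The generalized cross product of the rows r A with A != A0; it is polynomial in
    them, so that it depends smoothly on them. *)
Definition cross_product r (A0 k : 'I_n.+1) : R :=
  cofactor (\matrix_(A, k) r A k) A0 k.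

Let replace_row r A0 x : 'M[R]_n.+1 := \matrix_(A, k) if A == A0 then x k else r A k.

Let det_replace r A0 x : \det (replace_row r A0 x) = \sum_k x k * cross_product r A0 k.
Proof.
rewrite (expand_det_row _ A0); apply: eq_bigr => k _; rewrite mxE eqxx; congr (_ * _).
rewrite /cross_product /cofactor; congr (_ * \det _); apply/matrixP => i j.
by rewrite !mxE eq_sym (negPf (neq_lift _ _)).
Qed.

Lemma cross_product_orthogonal r A0 B : B != A0 ->
  \sum_k r B k * cross_product r A0 k = 0.
Proof.
move=> BA; rewrite -det_replace; apply: (determinant_alternate BA) => k.
by rewrite !mxE eqxx (negPf BA).
Qed.

Context (r : 'I_n.+1 -> 'I_n.+1 -> R) (A0 : 'I_n.+1).
Hypothesis r_orth : forall A B, A != A0 -> B != A0 ->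
  \sum_k r A k * r B k = (A == B)%:R.

(* A matrix with orthogonal rows times its transpose is diagonal. *)
Let det_replace_sqr x : (forall B, B != A0 -> \sum_k r B k * x k = 0) ->
  (\sum_k x k * cross_product r A0 k) ^+ 2 = \sum_k x k * x k.
Proof.
move=> xr; pose d : 'rV[R]_n.+1 := \row_A if A == A0 then \sum_k x k * x k else 1.
have E : replace_row r A0 x *m (replace_row r A0 x)^T = diag_mx d.
  apply/matrixP => A B; rewrite !mxE; under eq_bigr do rewrite !mxE.
  case: (boolP (A == A0)) => [/eqP->|AA]; case: (boolP (B == A0)) => [/eqP->|BA].
  - by rewrite eqxx mulr1n.
  - rewrite eq_sym (negPf BA) mulr0n -[RHS](xr _ BA).
    by apply: eq_bigr => k _; rewrite mulrC.
  - by rewrite (negPf AA) mulr0n -[RHS](xr _ AA).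
  - by rewrite r_orth.
rewrite -det_replace expr2 -{2}det_tr -det_mulmx E det_diag (bigD1 A0) //= mxE eqxx.
by rewrite [X in _ * X]big1 ?mulr1 // => A AA; rewrite mxE (negPf AA).
Qed.

(** The cross product q satisfies |q|^4 = |q|^2, by taking q itself as the missing
    row. It is not zero: taking as missing row a nonzero vector w orthogonal to all
    the others, <w, q>^2 = |w|^2. *)
Lemma cross_product_unit : \sum_k cross_product r A0 k * cross_product r A0 k = 1.
Proof.
pose q := \sum_k cross_product r A0 k * cross_product r A0 k.
have q2 : q ^+ 2 = q.
  by apply: det_replace_sqr => B BA; exact: cross_product_orthogonal.
have [q0|q0] := eqVneq q 0; last by apply: (mulfI q0); rewrite mulr1 -expr2.
pose K := kermx (row' A0 (\matrix_(A, k) r A k))^T.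
have Kn0 : K != 0.
  rewrite -mxrank_eq0 mxrank_ker -lt0n subn_gt0.
  by apply: leq_ltn_trans (rank_leq_col _) _.
have /rowV0Pn [w /sub_kermxP wK w0] := Kn0.
have wr B : B != A0 -> \sum_k r B k * w 0 k = 0.
  rewrite eq_sym => /unlift_some[B' -> _].
  have /matrixP /(_ 0 B') := wK; rewrite !mxE => E; rewrite -[RHS]E.
  by apply: eq_bigr => k _; rewrite !mxE mulrC.
have := det_replace_sqr wr; rewrite big1 => [|k _]; last first.
  suff -> : cross_product r A0 k = 0 by rewrite mulr0.
  apply/eqP/negPn/negP => c0.
  by have := sum_sqr_gt0 (ex_intro _ k c0); rewrite -/q q0 ltxx.
rewrite expr0n /= => W0; have : 0 < \sum_k w 0 k * w 0 k.
  apply: sum_sqr_gt0; apply: contrapT => /forallNP H; case/eqP: w0.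
  by apply/rowP => k; rewrite mxE; apply/eqP/negPn/negP => ?; exact: (H k).
by rewrite -W0 ltxx.
Qed.

End CrossProduct.

Section SmoothCrossProduct.
Context {R : realType} {V : normedModType R} (U : set V) (oU : open U).

Lemma smooth_det n (a : 'I_n -> 'I_n -> V -> R) : (forall i j, smooth_on U (a i j)) ->
  smooth_on U (fun u => \det (\matrix_(i, j) a i j u)).
Proof.
move=> sa; apply: smooth_sum => // s; apply: smoothM => //; first exact: smooth_cst.
apply: smooth_prod => // i.
by apply: (smooth_ext oU _ (sa i ((s : {perm _}) i))) => u _; rewrite mxE.
Qed.

Lemma smooth_cross_product n (a : 'I_n.+1 -> 'I_n.+1 -> V -> R) A0 k :
  (forall i j, smooth_on U (a i j)) ->
  smooth_on U (fun u => cross_product (fun A k => a A k u) A0 k).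
Proof.
move=> sa; apply: smoothM => //; first exact: smooth_cst.
apply: (smooth_ext oU _ (smooth_det (a := fun i j => a (lift A0 i) (lift k j)) _)) => // u _.
by congr (\det _); apply/matrixP => i j; rewrite !mxE.
Qed.

End SmoothCrossProduct.

(** * The frame adapted to a surface *)

Section AdaptedFrame.
Context {R : realType}.
Local Notation V := 'rV[R]_2.
Context (U : set V) (oU : open U) (phi T : 'I_5 -> V -> R).
Hypothesis sphi : forall k, smooth_on U (phi k).
Hypothesis sT : forall k, smooth_on U (T k).
Context (m : 'I_2 -> 'I_2 -> V -> R).
Hypothesis sm : forall a i, smooth_on U (m a i).
Hypothesis orthonormal : forall a b u, U u ->
  \sum_i \sum_j m a i u * m b j u * gram phi i j u = (a == b)%:R.
Local Notation D := (frame_derive m).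
Local Notation e a k := (D a (phi k)).
Local Notation ginv i j u := (\sum_a m a i u * m a j u).
Hypothesis phi_unit : forall u, U u -> \sum_k phi k u * phi k u = 1.
Hypothesis T_phi : forall u, U u -> \sum_k T k u * phi k u = 0.
Hypothesis T_e : forall a u, U u -> \sum_k T k u * e a k u = 0.
Context (h : R) (h_neq0 : h != 0).
Hypothesis T_norm : forall u, U u -> \sum_k T k u * T k u = (2 * h) ^+ 2.
(* T plays the role of the tension field: on normal vectors it is the trace of the
   second derivatives of phi, and T_biharmonic is the biharmonic equation paired with
   vectors tangent to the sphere. *)
Hypothesis T_trace : forall u (X : 'I_5 -> R), U u ->
  \sum_k X k * phi k u = 0 -> (forall a, \sum_k X k * e a k u = 0) ->
  \sum_k (\sum_i \sum_j ginv i j u * pder i (pder j (phi k)) u) * X k =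
  \sum_k T k u * X k.
Hypothesis T_biharmonic : forall u (X : 'I_5 -> R), U u ->
  \sum_k X k * phi k u = 0 ->
  \sum_k (\sum_i \sum_j ginv i j u * (pder i (pder j (T k)) u
    - \sum_l levi_civita phi m l i j u * pder l (T k) u)) * X k
  + 2 * \sum_k T k u * X k = 0.

Let xi k u := (2 * h)^-1 * T k u.

Let first_four (A k : 'I_5) (u : V) : R :=
  match val A with 0%N => phi k u | 1%N => e 0 k u | 2%N => e 1 k u | _ => xi k u end.

Let E (A k : 'I_5) (u : V) : R :=
  if A == i4 then cross_product (fun A k => first_four A k u) i4 k else first_four A k u.

Let se a k : smooth_on U (e a k).
Proof. exact: smooth_frame_derive. Qed.

Let sxi k : smooth_on U (xi k).
Proof. by apply: smoothM => //; exact: smooth_cst. Qed.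

Let sff A k : smooth_on U (first_four A k).
Proof.
elim/ord5_ind: A; [exact: sphi|exact: se|exact: se|exact: sxi|exact: sxi].
Qed.

Let sE A k : smooth_on U (E A k).
Proof.
rewrite /E; case: (A == i4); last exact: sff.
exact: (smooth_cross_product oU).
Qed.

Let phi_e a u : U u -> \sum_k phi k u * e a k u = 0.
Proof.
move=> Uu; have : D a (fun u => \sum_k phi k u * phi k u) u = 0.
  by rewrite (frame_derive_ext m a oU phi_unit Uu) frame_derive_cst.
rewrite (frame_derive_sum oU _ _ _ Uu) => [H|k]; last exact: smoothM.
have n2 : (2 : R) != 0 by rewrite pnatr_eq0.
apply: (mulfI n2); rewrite mulr0 -[RHS]H mulr_sumr; apply: eq_bigr => k _.
by rewrite (frame_deriveM m a (sphi k) (sphi k) Uu); ring.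
Qed.

Let h2 : 2 * h != 0.
Proof. by rewrite mulf_neq0 // pnatr_eq0. Qed.

Let xi_dot u (X : 'I_5 -> R) : \sum_k xi k u * X k = (2 * h)^-1 * \sum_k T k u * X k.
Proof. by rewrite mulr_sumr; apply: eq_bigr => k _; rewrite /xi mulrA. Qed.

Let dotC (x y : 'I_5 -> R) : \sum_k x k * y k = \sum_k y k * x k.
Proof. by apply: eq_bigr => k _; rewrite mulrC. Qed.

Let xi_xi u : U u -> \sum_k xi k u * xi k u = 1.
Proof.
move=> Uu; rewrite xi_dot dotC xi_dot T_norm // expr2.
by rewrite (mulKf h2) mulVf.
Qed.

Let ff_orth u : U u -> forall A B, A != i4 -> B != i4 ->
  \sum_k first_four A k u * first_four B k u = (A == B)%:R.
Proof.
move=> Uu; have te a b := tangent_frame_orthonormal orthonormal a b Uu.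
have xphi : \sum_k xi k u * phi k u = 0 by rewrite xi_dot T_phi // mulr0.
have xe a : \sum_k xi k u * e a k u = 0 by rewrite xi_dot T_e // mulr0.
elim/ord5_ind; elim/ord5_ind => // _ _;
  do [exact: phi_unit|exact: phi_e|exact: te|exact: xphi|exact: xe|exact: xi_xi|
      rewrite dotC; do [exact: phi_e|exact: xphi|exact: xe]].
Qed.

Let E_orth A B u : U u -> \sum_k E A k u * E B k u = (A == B)%:R.
Proof.
move=> Uu; rewrite /E; case: (boolP (A == i4)) => [/eqP->|A4];
  case: (boolP (B == i4)) => [/eqP->|B4].
- by rewrite eqxx; exact: cross_product_unit (ff_orth Uu).
- rewrite eq_sym (negPf B4) dotC.
  exact: (cross_product_orthogonal (fun A k => first_four A k u) B4).
- rewrite (negPf A4).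
  exact: (cross_product_orthogonal (fun A k => first_four A k u) A4).
- exact: ff_orth.
Qed.

Local Notation theta := (connection_form m E).

Let E3 : E i3 = xi. Proof. by []. Qed.

Let thetaE a A B u : theta a A B u = \sum_k D a (E A k) u * E B k u.
Proof. by rewrite connection_formE. Qed.

Let position u : U u ->
  [/\ theta 0 i0 i1 u = 1, theta 0 i0 i2 u = 0,
      theta 1 i0 i1 u = 0 & theta 1 i0 i2 u = 1] /\
  [/\ theta 0 i0 i3 u = 0, theta 0 i0 i4 u = 0,
      theta 1 i0 i3 u = 0 & theta 1 i0 i4 u = 0].
Proof.
move=> Uu; have P0 B : theta 0 i0 B u = (i1 == B)%:R.
  by rewrite thetaE; exact: (E_orth i1 B Uu).
have P1 B : theta 1 i0 B u = (i2 == B)%:R.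
  by rewrite thetaE; exact: (E_orth i2 B Uu).
by rewrite !P0 !P1.
Qed.

Let comm g u : U u -> smooth_on U g -> D 0 (D 1 g) u - D 1 (D 0 g) u =
  - theta 0 i1 i2 u * D 0 g u + - theta 1 i1 i2 u * D 1 g u.
Proof.
by move=> Uu sg; rewrite !thetaE (frame_commutator oU sphi sm orthonormal sg Uu).
Qed.

Let orth_phi B u : U u -> B != i0 -> \sum_k E B k u * phi k u = 0.
Proof. by move=> Uu B0; have := E_orth B i0 Uu; rewrite (negPf B0). Qed.

Let mean_trace B u : U u -> B != i0 -> B != i1 -> B != i2 ->
  theta 0 i1 B u + theta 1 i2 B u = 2 * h * (i3 == B)%:R.
Proof.
move=> Uu B0 B1 B2.
have XE a : \sum_k E B k u * e a k u = 0.
  elim/ord2_ind: a; first by have := E_orth B i1 Uu; rewrite (negPf B1).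
  by have := E_orth B i2 Uu; rewrite (negPf B2).
have XP j : \sum_k pder j (phi k) u * E B k u = 0.
  have -> : \sum_k pder j (phi k) u * E B k u =
     \sum_a frame_component phi m j a u * \sum_k E B k u * e a k u.
    rewrite sum2 !mulr_sumr -big_split /=; apply: eq_bigr => k _.
    by rewrite (pder_frame orthonormal j (phi k) Uu) sum2; ring.
  by rewrite sum2 !XE !mulr0 addr0.
have -> : 2 * h * (i3 == B)%:R = \sum_k T k u * E B k u.
  by rewrite -(E_orth i3 B Uu) xi_dot mulrA mulfV // mul1r.
rewrite -(T_trace Uu (orth_phi Uu B0) XE) !thetaE -big_split /=.
have -> : \sum_k (D 0 (e 0 k) u * E B k u + D 1 (e 1 k) u * E B k u) =
    \sum_k (\sum_i \sum_j ginv i j u * pder i (pder j (phi k)) u) * E B k u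
    + \sum_j (\sum_a D a (m a j) u) * \sum_k pder j (phi k) u * E B k u.
  rewrite [X in _ + X]sum2 !mulr_sumr -!big_split /=; apply: eq_bigr => k _.
  by rewrite !(frame_derive2 oU sm _ _ (sphi k) Uu) !sum2; ring.
by rewrite [X in _ + X]sum2 !XP !mulr0 !addr0.
Qed.

Let Dxi a k u : U u -> D a (xi k) u = (2 * h)^-1 * D a (T k) u.
Proof.
move=> Uu; rewrite (frame_deriveM m a (smooth_cst oU _) (sT k) Uu).
by rewrite frame_derive_cst mul0r add0r.
Qed.

Let DDxi a k u : U u -> D a (D a (xi k)) u = (2 * h)^-1 * D a (D a (T k)) u.
Proof.
move=> Uu; rewrite (frame_derive_ext m a oU (Dxi a k) Uu).
have sDT : smooth_on U (D a (T k)) by exact: smooth_frame_derive.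
rewrite (frame_deriveM m a (smooth_cst oU _) sDT Uu).
by rewrite frame_derive_cst mul0r add0r.
Qed.

Let biharmonic_frame C u : U u -> C != i0 ->
  \sum_k D 0 (D 0 (E i3 k)) u * E C k u + \sum_k D 1 (D 1 (E i3 k)) u * E C k u
  - theta 0 i1 i2 u * theta 1 i3 C u + theta 1 i1 i2 u * theta 0 i3 C u
  + 2 * (C == i3)%:R = 0.
Proof.
move=> Uu C0; have := T_biharmonic Uu (orth_phi Uu C0).
have -> : \sum_k T k u * E C k u = 2 * h * (C == i3)%:R.
  by rewrite eq_sym -(E_orth i3 C Uu) xi_dot mulrA mulfV // mul1r.
under eq_bigr => k _ do
  rewrite (frame_laplacian oU sphi sm orthonormal (sT k) Uu).
rewrite -(thetaE 0 i1 i2) -(thetaE 1 i1 i2) => H.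
apply: (mulfI h2); rewrite mulr0 -[RHS]H.
rewrite (thetaE 1 i3 C) (thetaE 0 i3 C) E3.
have -> : \sum_k D 0 (D 0 (xi k)) u * E C k u =
    (2 * h)^-1 * \sum_k D 0 (D 0 (T k)) u * E C k u.
  by rewrite mulr_sumr; apply: eq_bigr => k _; rewrite DDxi // mulrA.
have -> : \sum_k D 1 (D 1 (xi k)) u * E C k u =
    (2 * h)^-1 * \sum_k D 1 (D 1 (T k)) u * E C k u.
  by rewrite mulr_sumr; apply: eq_bigr => k _; rewrite DDxi // mulrA.
have dxi a : \sum_k D a (xi k) u * E C k u = (2 * h)^-1 * \sum_k D a (T k) u * E C k u.
  by rewrite mulr_sumr; apply: eq_bigr => k _; rewrite Dxi // mulrA.
rewrite !dxi.
have -> : \sum_k (D 0 (D 0 (T k)) u + D 1 (D 1 (T k)) u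
    - theta 0 i1 i2 u * D 1 (T k) u + theta 1 i1 i2 u * D 0 (T k) u) * E C k u =
  \sum_k D 0 (D 0 (T k)) u * E C k u + \sum_k D 1 (D 1 (T k)) u * E C k u
  - theta 0 i1 i2 u * \sum_k D 1 (T k) u * E C k u
  + theta 1 i1 i2 u * \sum_k D 0 (T k) u * E C k u.
  rewrite !mulr_sumr -sumrN -!big_split /=; apply: eq_bigr => k _; ring.
have alg (c K S0 S1 X0 X1 p q b : R) : K * c = 1 ->
    K * (c * S0 + c * S1 - p * (c * X1) + q * (c * X0) + 2 * b) =
    S0 + S1 - p * X1 + q * X0 + 2 * (K * b).
  move=> Kc; have -> : K * (c * S0 + c * S1 - p * (c * X1) + q * (c * X0) + 2 * b) =
    (K * c) * (S0 + S1 - p * X1 + q * X0) + 2 * (K * b) by ring.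
  by rewrite Kc mul1r.
by apply: alg; rewrite mulfV.
Qed.

(** Since w = 0 and b = h Id, D_a xi = - h e_a; as T / 2 = h xi and h^2 = 1, the
    derivatives of phi and T / 2 cancel. *)
Theorem position_plus_normal_parallel u : U u ->
  h ^+ 2 = 1 /\ forall i k, pder i (fun u => phi k u + 2^-1 * T k u) u = 0.
Proof.
move=> Uu; have tb v : U v -> theta 0 i1 i3 v + theta 1 i2 i3 v = 2 * h.
  by move=> Uv; rewrite mean_trace // mulr1.
have tc v : U v -> theta 0 i1 i4 v + theta 1 i2 i4 v = 0.
  by move=> Uv; rewrite mean_trace // mulr0.
have [h1 [b11 b12 b22 b21]] := umbilical_along_mean_curvature oU sm sE E_orth comm
  position h_neq0 tb tc biharmonic_frame Uu.
have [w0 w1] := normal_connection_flat oU sm sE E_orth comm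
  position h_neq0 tb tc biharmonic_frame Uu.
split => // i k.
have sk a A B := connection_form_skew oU m sE E_orth a A B Uu.
have [_ [x03 _ x13 _]] := position Uu.
have Dx a : D a (xi k) u = - h * e a k u.
  have -> : D a (xi k) u = \sum_B theta a i3 B u * E B k u.
    rewrite (frame_expand E_orth (fun k => D a (xi k) u) k Uu).
    by apply: eq_bigr => B _; rewrite thetaE.
  rewrite sum5 (sk a i0 i3) (sk a i1 i3) (sk a i2 i3).
  have := sk a i3 i3; rewrite (_ : E i1 k u = e 0 k u) // (_ : E i2 k u = e 1 k u) //.
  move: (E i0 k u) (E i3 k u) (E i4 k u) => q0 q3 q4 s33.
  have -> : theta a i3 i3 u = 0 by lra.
  by elim/ord2_ind: a {s33}; rewrite ?w0 ?w1 ?x03 ?x13 ?b11 ?b12 ?b22 ?b21; ring.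
have sTk : smooth_on U (fun u => 2^-1 * T k u).
  by apply: smoothM => //; exact: smooth_cst.
rewrite (pder_frame orthonormal i _ Uu) big1 // => a _.
rewrite (frame_deriveD m a (sphi k) sTk Uu).
rewrite (frame_deriveM m a (smooth_cst oU _) (sT k) Uu) frame_derive_cst mul0r add0r.
have -> : D a (T k) u = 2 * h * D a (xi k) u by rewrite Dxi // mulrA mulfV // mul1r.
rewrite Dx (_ : 2^-1 * (2 * h * (- h * e a k u)) = - h ^+ 2 * e a k u).
  by rewrite h1; ring.
by field.
Qed.

End AdaptedFrame.

(** * Dot products and the curvature of the sphere *)

Section DotProduct.
Context {R : realType} {n : nat}.
Implicit Types (x y z : 'rV[R]_n) (a : R).

Lemma dotE x y : dot x y = \sum_k x 0 k * y 0 k.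
Proof. by rewrite /dot mxE; apply: eq_bigr => k _; rewrite mxE. Qed.

Lemma dotC x y : dot x y = dot y x.
Proof. by rewrite !dotE; apply: eq_bigr => k _; rewrite mulrC. Qed.

Lemma dotDl x y z : dot (x + y) z = dot x z + dot y z.
Proof. by rewrite /dot mulmxDl mxE. Qed.

Lemma dotNl x y : dot (- x) y = - dot x y.
Proof. by rewrite /dot mulNmx mxE. Qed.

Lemma dotZl a x y : dot (a *: x) y = a * dot x y.
Proof. by rewrite /dot -scalemxAl mxE. Qed.

Lemma dotDr x y z : dot x (y + z) = dot x y + dot x z.
Proof. by rewrite dotC dotDl !(dotC x). Qed.

Lemma dotNr x y : dot x (- y) = - dot x y.
Proof. by rewrite dotC dotNl (dotC x). Qed.

Lemma dotZr a x y : dot x (a *: y) = a * dot x y.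
Proof. by rewrite dotC dotZl (dotC x). Qed.

Lemma dot0l x : dot 0 x = 0.
Proof. by rewrite /dot mul0mx mxE. Qed.

Lemma dot_suml (I : finType) (F : I -> 'rV[R]_n) x :
  dot (\sum_i F i) x = \sum_i dot (F i) x.
Proof. by rewrite /dot mulmx_suml summxE. Qed.

Lemma dot_ge0 x : 0 <= dot x x.
Proof. by rewrite dotE sumr_ge0 // => k _; rewrite -expr2 sqr_ge0. Qed.

Lemma dot_eq0 x : dot x x = 0 -> x = 0.
Proof.
move=> x0; apply/rowP => k; rewrite mxE; apply/eqP/negPn/negP => xk.
have := sum_sqr_gt0 (x := fun k => x 0 k) (ex_intro _ k xk).
by rewrite -dotE x0 ltxx.
Qed.

Lemma sqr_enorm x : enorm x ^+ 2 = dot x x.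
Proof. by rewrite /enorm sqr_sqrtr // dot_ge0. Qed.

Lemma dotBl x y z : dot (x - y) z = dot x z - dot y z.
Proof. by rewrite dotDl dotNl. Qed.

Lemma dotBr x y z : dot x (y - z) = dot x y - dot x z.
Proof. by rewrite dotDr dotNr. Qed.

End DotProduct.

Section VectorDerivatives.
Context {R : realType} {V : normedModType R} {n : nat}.
Implicit Types (F G : V -> 'rV[R]_n) (g : V -> R).

Lemma is_derive_coord F (x v : V) (dF : 'rV[R]_n) k : is_derive x v F dF ->
  is_derive x v (fun p => F p 0 k) (dF 0 k).
Proof.
move=> [Fd FE]; apply: DeriveDef; first by have /derivable_mxP := Fd; apply.
by rewrite -derive_coord // FE.
Qed.

Lemma is_derive_row F (x v : V) (dF : 'rV[R]_n) :
  (forall k, is_derive x v (fun p => F p 0 k) (dF 0 k)) -> is_derive x v F dF.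
Proof.
move=> H; have Fd : derivable F x v.
  by apply/derivable_mxP => i k; rewrite ord1; have [] := H k.
apply: DeriveDef => //; apply/rowP => k; rewrite derive_coord //.
by have [_] := H k.
Qed.

Lemma is_derive_scale g F (x v : V) (dg : R) (dF : 'rV[R]_n) : is_derive x v g dg ->
  is_derive x v F dF -> is_derive x v (fun p => g p *: F p) (dg *: F x + g x *: dF).
Proof.
move=> Hg HF; apply: is_derive_row => k; have := is_deriveM Hg (is_derive_coord k HF).
have -> : (fun p => (g p *: F p) 0 k) = g * (fun p => F p 0 k).
  by apply/funext => p; rewrite mxE.
by rewrite !mxE addrC [dg * _]mulrC.
Qed.

Lemma is_derive_dot F G (x v : V) (dF dG : 'rV[R]_n) : is_derive x v F dF ->
  is_derive x v G dG ->
  is_derive x v (fun p => dot (F p) (G p)) (dot dF (G x) + dot (F x) dG).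
Proof.
move=> HF HG.
have -> : (fun p => dot (F p) (G p)) = \sum_k (fun p => F p 0 k) * (fun p => G p 0 k).
  by apply/funext => p; rewrite dotE fct_sumE.
have := @is_derive_sum _ _ _ n (fun k => (fun p => F p 0 k) * (fun p => G p 0 k)) x v _
  (fun k => is_deriveM (is_derive_coord k HF) (is_derive_coord k HG)).
rewrite !dotE -big_split /= => H; congr (is_derive _ _ _ _): H.
by apply: eq_bigr => k _; rewrite addrC [dF 0 k * _]mulrC.
Qed.

End VectorDerivatives.

Section SphereCurvature.
Context {R : realType}.
Implicit Types (p q w x y z : 'rV[R]_5).

Let is_derive_proj z p w :
  is_derive p w (fun p => proj_S4 p z) (- (dot z w *: p + dot z p *: w)).
Proof.
have H := is_derive_scale (is_derive_dot (is_derive_cst z p w) (is_derive_id p w))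
  (is_derive_id p w).
have := is_deriveB (is_derive_cst z p w) H.
by rewrite dot0l sub0r add0r.
Qed.

Let nabla_proj y z p : ambient_nabla (@proj_S4 R) (fun p => proj_S4 p y)
    (fun p => proj_S4 p z) p =
  proj_S4 p (- (dot z (proj_S4 p y) *: p + dot z p *: proj_S4 p y)).
Proof.
by rewrite /ambient_nabla; have [_ ->] := is_derive_proj z p (proj_S4 p y).
Qed.

Let nabla2_proj q x y z : dot q q = 1 -> dot x q = 0 -> dot y q = 0 -> dot z q = 0 ->
  ambient_nabla (@proj_S4 R) (fun p => proj_S4 p x)
    (ambient_nabla (@proj_S4 R) (fun p => proj_S4 p y) (fun p => proj_S4 p z)) q =
  - (dot z x *: y).
Proof.
move=> qq xq yq zq; rewrite {1}/ambient_nabla.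
have -> : ambient_nabla (@proj_S4 R) (fun p => proj_S4 p y) (fun p => proj_S4 p z) =
   fun p => proj_S4 p (- (dot z (proj_S4 p y) *: p + dot z p *: proj_S4 p y)).
  by apply/funext => p; exact: nabla_proj.
have Pq w : dot w q = 0 -> proj_S4 q w = w by rewrite /proj_S4 => ->; rewrite scale0r subr0.
rewrite (Pq x xq).
have Hp := is_derive_id q x.
have HY := is_derive_proj y q x.
have Hz := is_derive_cst z q x.
have Hv := is_deriveN (is_deriveD (is_derive_scale (is_derive_dot Hz HY) Hp)
  (is_derive_scale (is_derive_dot Hz Hp) HY)).
have [_ ->] := is_deriveB Hv (is_derive_scale (is_derive_dot Hv Hp) Hp).
rewrite /cst (Pq y yq) !dot0l !add0r.
rewrite !fctE (Pq y yq) zq yq !scale0r !addr0.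
rewrite !(dotNl, dotNr, dotDl, dotDr, dotZl, dotZr) qq xq yq zq (dotC q x) xq.
rewrite !(mulr0, oppr0, addr0, add0r, scale0r, scaler0, mulr1).
rewrite scaleNr opprK opprD addrAC addNr add0r Pq //.
by rewrite dotNl dotZl yq mulr0 oppr0.
Qed.

(** The fields p |-> z - <z, p> p are polynomial in p, and their covariant
    derivatives along the sphere are computed by the product rule. *)
Lemma curvature_S4 q x y z : dot q q = 1 -> dot x q = 0 -> dot y q = 0 -> dot z q = 0 ->
  curvature (@proj_S4 R) q x y z = dot z y *: x - dot z x *: y.
Proof.
move=> qq xq yq zq; rewrite /curvature; cbv zeta; rewrite !nabla2_proj // /ambient_nabla.
have -> : lie_bracket (fun p => proj_S4 p x) (fun p => proj_S4 p y) q = 0.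
  have Pq w : dot w q = 0 -> proj_S4 q w = w by rewrite /proj_S4 => ->; rewrite scale0r subr0.
  rewrite /lie_bracket !Pq //.
  have [_ ->] := is_derive_proj y q x; have [_ ->] := is_derive_proj x q y.
  by rewrite xq yq !scale0r !addr0 (dotC y x) subrr.
rewrite derive0 /proj_S4 dot0l scale0r !subr0 opprK addrC.
by [].
Qed.

End SphereCurvature.

(** * Tension and bitension of an immersed surface in the adapted frame *)

Definition coordinate (R : realType) (n : nat) (F : 'rV[R]_2 -> 'rV[R]_n) (k : 'I_n)
  (u : 'rV[R]_2) : R := F u 0 k.

Section ImmersedSurface.
Context {R : realType}.
Local Notation V := 'rV[R]_2.
Context (U : set V) (oU : open U) (f : V -> 'rV[R]_5).
Hypothesis sf : smooth_on U f.
Hypothesis f_immersive : forall u, U u -> forall v, 'D_v f u = 0 -> v = 0.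
Hypothesis f_S4 : forall u, U u -> dot (f u) (f u) = 1.

Local Notation phi := (coordinate f).

Lemma pd_coord n (F : V -> 'rV[R]_n) i u k :
  (forall k, smooth_on U (coordinate F k)) -> U u ->
  pd i F u 0 k = pder i (coordinate F k) u.
Proof.
move=> sF Uu; rewrite pderE /pd derive_coord //; apply/derivable_mxP => a b.
by rewrite ord1; exact: smooth_derivable (sF b) Uu.
Qed.

Let sphi k : smooth_on U (phi k).
Proof. exact: (smooth_coord k oU sf). Qed.

Let pdf i u k : U u -> pd i f u 0 k = pder i (phi k) u.
Proof. by move=> Uu; exact: pd_coord. Qed.

Lemma smooth_pd_coord n (F : V -> 'rV[R]_n) i k :
  (forall k, smooth_on U (coordinate F k)) -> smooth_on U (coordinate (pd i F) k).
Proof.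
move=> sF; apply: (smooth_ext oU _ (smooth_pder i (sF k))) => u Uu.
by rewrite -pd_coord.
Qed.

Lemma pd_pd_coord n (F : V -> 'rV[R]_n) i j u k :
  (forall k, smooth_on U (coordinate F k)) -> U u ->
  pd i (pd j F) u 0 k = pder i (pder j (coordinate F k)) u.
Proof.
move=> sF Uu; rewrite pd_coord // => [|l]; last exact: smooth_pd_coord.
by apply: (pder_ext oU) => // v Uv; exact: pd_coord.
Qed.

Let indep u : U u -> forall a b : R,
  (forall k, a * pder 0 (phi k) u + b * pder 1 (phi k) u = 0) -> a = 0 /\ b = 0.
Proof.
move=> Uu a b H; pose v : V := a *: delta_mx 0 0 + b *: delta_mx 0 1.
have df := smooth_diff sf Uu.
have v0 : v = 0.
  apply: (f_immersive Uu); rewrite (deriveE _ df) linearD !linearZ /= -!(deriveE _ df).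
  apply/rowP => k; rewrite mxE [X in X + _]mxE [X in _ + X]mxE [RHS]mxE.
  by rewrite -[RHS](H k); congr (_ * _ + _ * _); exact: pdf.
have := congr1 (fun w : V => w 0 0) v0; have := congr1 (fun w : V => w 0 1) v0.
by rewrite !mxE /= !(mulr0, mulr1, addr0, add0r).
Qed.

Definition tangent_coframe := gram_schmidt phi.
Local Notation m := tangent_coframe.
Local Notation D := (frame_derive m).
Local Notation e a k := (D a (phi k)).
Local Notation ginv i j u := (\sum_a m a i u * m a j u).
Local Notation Gamma := (levi_civita phi m).

Let sm a i : smooth_on U (m a i).
Proof. exact: smooth_gram_schmidt. Qed.

Let orthonormal a b u : U u ->
  \sum_i \sum_j m a i u * m b j u * gram phi i j u = (a == b)%:R.
Proof. by move=> Uu; exact: (gram_schmidt_orthonormal indep). Qed.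

Let se a k : smooth_on U (e a k).
Proof. exact: smooth_frame_derive. Qed.

Let metricE u : U u -> metric f u = \matrix_(i, j) gram phi i j u.
Proof.
move=> Uu; apply/matrixP => i j; rewrite !mxE dotE gramE.
by apply: eq_bigr => k _; congr (_ * _); exact: pdf.
Qed.

Let ginvE i j u : U u -> invmx (metric f u) i j = ginv i j u.
Proof. by move=> Uu; rewrite metricE // (inverse_gram orthonormal). Qed.

Let christoffelE i j k u : U u -> christoffel f i j k u = Gamma k i j u.
Proof.
move=> Uu; pose S i j l := \sum_k pder i (pder j (phi k)) u * pder l (phi k) u.
have SC a b l : S a b l = S b a l.
  by apply: eq_bigr => n _; rewrite (pderC oU a b (sphi n) Uu).
have dg a b l : pd a (fun w => metric f w b l) u = S a b l + S a l b.
  have -> : pd a (fun w => metric f w b l) u = pder a (gram phi b l) u.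
    rewrite pderE; apply: (derive_ext oU) => // v Uv.
    by rewrite metricE // mxE.
  have sp c n : smooth_on U (pder c (phi n)) by exact: smooth_pder.
  rewrite gramE (pder_sum oU) // => [|n]; last exact: smoothM.
  rewrite -big_split; apply: eq_bigr => n _ /=.
  by rewrite (pderM _ (sp _ _) (sp _ _) Uu); ring.
rewrite /christoffel.
have -> : \sum_l invmx (metric f u) k l *
    (pd i (fun w => metric f w j l) u + pd j (fun w => metric f w i l) u
     - pd l (fun w => metric f w i j) u) = \sum_l 2 * (ginv k l u * S i j l).
  apply: eq_bigr => l _; rewrite ginvE // !dg (SC l i) (SC l j) (SC j i); ring.
rewrite -mulr_sumr mulKf ?pnatr_eq0 // /levi_civita /hessian_component.
rewrite !sum2 /S !mulr_sumr -!big_split /=; apply: eq_bigr => n _.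
by rewrite !frame_deriveE !sum2; ring.
Qed.

Local Notation hphi i j u := (\sum_n pder i (pder j (phi n)) u * phi n u).
Local Notation tau := (tension (@proj_S4 R) f).
Local Notation T := (coordinate tau).

Let pdpdf i j u k : U u -> pd i (pd j f) u 0 k = pder i (pder j (phi k)) u.
Proof. by move=> Uu; exact: pd_pd_coord. Qed.

Let second_form_coord i j u k : U u -> second_form (@proj_S4 R) f i j u 0 k =
  pder i (pder j (phi k)) u - hphi i j u * phi k u - \sum_l Gamma l i j u * pder l (phi k) u.
Proof.
move=> Uu; rewrite /second_form /nabla_along /proj_S4 mxE [X in X + _]mxE.
congr (_ + _ + _); [exact: pdpdf| |].
  rewrite !mxE dotE; congr (- (_ * _)).
  by apply: eq_bigr => n _; rewrite pdpdf.
rewrite mxE summxE; congr (- _); apply: eq_bigr => l _.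
by rewrite mxE christoffelE // pdf.
Qed.

Lemma trace_g_coord A u k : U u ->
  trace_g f u A 0 k = \sum_i \sum_j ginv i j u * A i j 0 k.
Proof.
move=> Uu; rewrite /trace_g summxE; apply: eq_bigr => i _; rewrite summxE.
by apply: eq_bigr => j _; rewrite mxE ginvE.
Qed.

Let tension_coord u k : U u -> T k u = \sum_i \sum_j ginv i j u *
  (pder i (pder j (phi k)) u - hphi i j u * phi k u - \sum_l Gamma l i j u * pder l (phi k) u).
Proof.
move=> Uu; rewrite /coordinate /tension trace_g_coord //; apply: eq_bigr => i _.
by apply: eq_bigr => j _; rewrite second_form_coord.
Qed.

Let spp i j k : smooth_on U (pder i (pder j (phi k))).
Proof. by do 2 apply: smooth_pder. Qed.

Let sT k : smooth_on U (T k).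
Proof.
have sG i j l : smooth_on U (Gamma l i j).
  apply: smooth_sum => // c; apply: smoothM => //; apply: smooth_sum => // n.
  exact: smoothM.
apply: (smooth_ext oU (fun u Uu => esym (tension_coord k Uu))).
apply: smooth_sum => // i; apply: smooth_sum => // j; apply: smoothM => //.
  by apply: smooth_sum => // a; exact: smoothM.
apply: smoothB => //; last first.
  by apply: smooth_sum => // l; apply: smoothM => //; exact: smooth_pder.
apply: smoothB => //; apply: smoothM => //; apply: smooth_sum => // n.
exact: smoothM.
Qed.

Let phi_unit u : U u -> \sum_k phi k u * phi k u = 1.
Proof. by move=> Uu; rewrite -(f_S4 Uu) dotE. Qed.

Let n2 : (2 : R) != 0. Proof. by rewrite pnatr_eq0. Qed.

Let pder_phi l u : U u -> \sum_k pder l (phi k) u * phi k u = 0.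
Proof.
move=> Uu; have : pder l (fun u => \sum_k phi k u * phi k u) u = 0.
  by rewrite (pder_ext oU l phi_unit Uu) pder_cst.
rewrite (pder_sum oU) // => [H|k]; last exact: smoothM.
apply: (mulfI n2); rewrite mulr0 -[RHS]H mulr_sumr; apply: eq_bigr => k _.
by rewrite (pderM _ (sphi k) (sphi k) Uu); ring.
Qed.

Let e_dot a (X : 'I_5 -> R) u : \sum_k e a k u * X k =
  \sum_l m a l u * \sum_k pder l (phi k) u * X k.
Proof.
rewrite sum2 !mulr_sumr -big_split /=; apply: eq_bigr => k _.
by rewrite frame_deriveE sum2; ring.
Qed.

Let e_phi a u : U u -> \sum_k e a k u * phi k u = 0.
Proof. by move=> Uu; rewrite e_dot big1 // => l _; rewrite pder_phi // mulr0. Qed.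

Let pder_dot l (X : 'I_5 -> R) u : U u -> \sum_k pder l (phi k) u * X k =
  \sum_a frame_component phi m l a u * \sum_k e a k u * X k.
Proof.
move=> Uu; rewrite sum2 !mulr_sumr -big_split /=; apply: eq_bigr => k _.
by rewrite (pder_frame orthonormal l (phi k) Uu) sum2; ring.
Qed.

Let T_dot (X : 'I_5 -> R) u : U u -> \sum_k T k u * X k = \sum_i \sum_j ginv i j u *
  (\sum_k pder i (pder j (phi k)) u * X k - hphi i j u * \sum_k phi k u * X k
   - \sum_l Gamma l i j u * \sum_k pder l (phi k) u * X k).
Proof.
move=> Uu; under eq_bigr => k _ do rewrite tension_coord // mulr_suml.
rewrite exchange_big /=; apply: eq_bigr => i _.
under eq_bigr => k _ do rewrite mulr_suml.
rewrite exchange_big /=; apply: eq_bigr => j _.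
move: (\sum_a m a i u * m a j u) (\sum_n pder i (pder j (phi n)) u * phi n u) => G hh.
rewrite [in RHS]sum2 !mulr_sumr -big_split -!sumrN -!big_split /= mulr_sumr.
by apply: eq_bigr => k _; rewrite sum2; ring.
Qed.

Let T_phi u : U u -> \sum_k T k u * phi k u = 0.
Proof.
move=> Uu; rewrite T_dot // big1 // => i _; rewrite big1 // => j _.
rewrite phi_unit // [X in _ - X]big1 => [|l _]; last by rewrite pder_phi // mulr0.
by rewrite mulr1 subrr subr0 mulr0.
Qed.

Let T_e a u : U u -> \sum_k T k u * e a k u = 0.
Proof.
move=> Uu; rewrite T_dot // big1 // => i _; rewrite big1 // => j _.
have -> : \sum_k phi k u * e a k u = 0.
  by rewrite -[RHS](e_phi a Uu); apply: eq_bigr => k _; rewrite mulrC.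
have -> : \sum_l Gamma l i j u * \sum_k pder l (phi k) u * e a k u =
    \sum_k pder i (pder j (phi k)) u * e a k u.
  have -> : \sum_l Gamma l i j u * \sum_k pder l (phi k) u * e a k u =
     \sum_c hessian_component phi m i j c u * \sum_k e c k u * e a k u.
    by rewrite /levi_civita !sum2 !(e_dot _ (fun k => e a k u)) !sum2; ring.
  rewrite sum2 !(tangent_frame_orthonormal orthonormal _ _ Uu).
  by elim/ord2_ind: a => /=; rewrite mulr0 mulr1 ?addr0 ?add0r.
by rewrite mulr0 subr0 subrr mulr0.
Qed.

Let T_trace u (X : 'I_5 -> R) : U u ->
  \sum_k X k * phi k u = 0 -> (forall a, \sum_k X k * e a k u = 0) ->
  \sum_k (\sum_i \sum_j ginv i j u * pder i (pder j (phi k)) u) * X k =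
  \sum_k T k u * X k.
Proof.
move=> Uu Xphi Xe; rewrite T_dot //.
have phiX : \sum_k phi k u * X k = 0.
  by rewrite -[RHS]Xphi; apply: eq_bigr => k _; rewrite mulrC.
have pX l : \sum_k pder l (phi k) u * X k = 0.
  rewrite pder_dot // big1 // => a _.
  rewrite (_ : \sum_k _ = 0) ?mulr0 // -[RHS](Xe a).
  by apply: eq_bigr => k _; rewrite mulrC.
under eq_bigr => k _ do rewrite mulr_suml.
rewrite exchange_big /=; apply: eq_bigr => i _.
under eq_bigr => k _ do rewrite mulr_suml.
rewrite exchange_big /=; apply: eq_bigr => j _.
rewrite phiX mulr0 subr0 [X in _ - X]big1 => [|l _]; last by rewrite pX mulr0.
by rewrite subr0 mulr_sumr; apply: eq_bigr => k _; rewrite mulrA.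
Qed.

Let trace_gram u : U u -> \sum_i \sum_j ginv i j u * gram phi i j u = 2.
Proof.
move=> Uu; have <- : \sum_a \sum_i \sum_j m a i u * m a j u * gram phi i j u = 2.
  by rewrite sum2 !orthonormal // eqxx.
by rewrite !sum2; ring.
Qed.

Let T_pder l u : U u -> \sum_k T k u * pder l (phi k) u = 0.
Proof.
move=> Uu; have -> : \sum_k T k u * pder l (phi k) u = \sum_k pder l (phi k) u * T k u.
  by apply: eq_bigr => k _; rewrite mulrC.
rewrite pder_dot // big1 // => a _; rewrite (_ : \sum_k _ = 0) ?mulr0 // -[RHS](T_e a Uu).
by apply: eq_bigr => k _; rewrite mulrC.
Qed.

Let pder_T_phi l u : U u -> \sum_k pder l (T k) u * phi k u = 0.
Proof.
move=> Uu; have : pder l (fun u => \sum_k T k u * phi k u) u = 0.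
  by rewrite (pder_ext oU l T_phi Uu) pder_cst.
rewrite (pder_sum oU) // => [H|k]; last exact: smoothM.
rewrite -[RHS]H -[LHS]addr0 -[X in _ + X](T_pder l Uu) -big_split /=.
by apply: eq_bigr => k _; rewrite (pderM _ (sT k) (sphi k) Uu).
Qed.

Let nabla_tau j u : U u -> nabla_along (@proj_S4 R) f j tau u = pd j tau u.
Proof.
move=> Uu; rewrite /nabla_along /proj_S4 (_ : dot _ _ = 0) ?scale0r ?subr0 //.
rewrite dotE -[RHS](pder_T_phi j Uu); apply: eq_bigr => k _; congr (_ * _).
exact: (pd_coord j k sT Uu).
Qed.

Let nabla2_tau i j u k : U u ->
  nabla_along (@proj_S4 R) f i (nabla_along (@proj_S4 R) f j tau) u 0 k =
  pder i (pder j (T k)) u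
  - dot (pd i (nabla_along (@proj_S4 R) f j tau) u) (f u) * phi k u.
Proof.
move=> Uu; rewrite {1}/nabla_along /proj_S4 mxE; congr (_ + _); last by rewrite !mxE.
rewrite /pd (derive_ext oU (g := pd j tau)) // => [|v Uv]; last exact: nabla_tau.
exact: pd_pd_coord.
Qed.

Context (h : R) (h_neq0 : h != 0).
Hypothesis f_cmc : forall u, U u -> enorm (mean_curvature_field (@proj_S4 R) f u) = h.
Hypothesis f_biharmonic : forall u, U u -> bitension (@proj_S4 R) f u = 0.

Lemma tension_sqr u : U u -> dot (tau u) (tau u) = (2 * h) ^+ 2.
Proof.
move=> Uu; rewrite exprMn -(f_cmc Uu) sqr_enorm /mean_curvature_field dotZl dotZr.
by rewrite -/(tau u); field.
Qed.

Let T_norm u : U u -> \sum_k T k u * T k u = (2 * h) ^+ 2.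
Proof. by move=> Uu; rewrite -(tension_sqr Uu) dotE. Qed.

Let bitension_coord u k : U u ->
  \sum_i \sum_j ginv i j u *
    (pder i (pder j (T k)) u - \sum_l Gamma l i j u * pder l (T k) u
     - dot (pd i (nabla_along (@proj_S4 R) f j tau) u) (f u) * phi k u)
  + 2 * T k u = 0.
Proof.
move=> Uu; have := congr1 (fun w : 'rV[R]_5 => w 0 k) (f_biharmonic Uu).
rewrite /bitension /rough_laplacian opprK mxE [X in _ + X]mxE !trace_g_coord // [RHS]mxE.
move=> H; rewrite -[RHS]H -{1}(trace_gram Uu); congr (_ + _).
  apply: eq_bigr => i _; apply: eq_bigr => j _; congr (_ * _).
  rewrite mxE nabla2_tau // [in RHS]mxE summxE -addrA [- _ - _]addrC addrA; congr (_ - _).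
  apply: eq_bigr => l _; rewrite mxE christoffelE // nabla_tau //; congr (_ * _).
  exact/esym/(pd_coord l k sT Uu).
rewrite mulr_suml -sumrN; apply: eq_bigr => i _; rewrite mulr_suml -sumrN.
apply: eq_bigr => j _; have Fphi l : dot (pd l f u) (f u) = 0.
  rewrite dotE -[RHS](pder_phi l Uu); apply: eq_bigr => n _; congr (_ * _); exact: pdf.
rewrite curvature_S4 ?f_S4 //; last by rewrite dotE; exact: T_phi.
have -> : dot (pd j f u) (tau u) = 0.
  rewrite dotE -[RHS](T_pder j Uu); apply: eq_bigr => n _; rewrite mulrC.
  by congr (_ * _); exact: pdf.
have -> : dot (pd j f u) (pd i f u) = gram phi i j u.
  rewrite gramE dotE; apply: eq_bigr => n _; rewrite mulrC.
  by congr (_ * _); exact: pdf.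
by rewrite scale0r add0r !mxE mulrN opprK mulrA.
Qed.

Let T_biharmonic u (X : 'I_5 -> R) : U u ->
  \sum_k X k * phi k u = 0 ->
  \sum_k (\sum_i \sum_j ginv i j u * (pder i (pder j (T k)) u
    - \sum_l Gamma l i j u * pder l (T k) u)) * X k
  + 2 * \sum_k T k u * X k = 0.
Proof.
move=> Uu Xphi.
pose q i j := dot (pd i (nabla_along (@proj_S4 R) f j tau) u) (f u).
have Q : (\sum_i \sum_j ginv i j u * q i j) * \sum_k X k * phi k u = 0 by rewrite Xphi mulr0.
have H : \sum_k (\sum_i \sum_j ginv i j u *
    (pder i (pder j (T k)) u - \sum_l Gamma l i j u * pder l (T k) u - q i j * phi k u)
    + 2 * T k u) * X k = 0.
  by rewrite big1 // => k _; rewrite bitension_coord // mul0r.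
have lin (B : 'I_2 -> 'I_2 -> R) y : \sum_i \sum_j ginv i j u * (B i j - q i j * y) =
    \sum_i \sum_j ginv i j u * B i j - (\sum_i \sum_j ginv i j u * q i j) * y.
  rewrite mulr_suml -sumrB; apply: eq_bigr => i _; rewrite mulr_suml -sumrB.
  by apply: eq_bigr => j _; ring.
move: H Q; under eq_bigr => k _ do rewrite lin.
move: (\sum_i \sum_j ginv i j u * q i j) => qq H Q.
rewrite -[RHS]H -[LHS]subr0 -[X in _ - X]Q !mulr_sumr -sumrN -!big_split /=.
by apply: eq_bigr => k _; ring.
Qed.

Theorem unit_mean_curvature_parallel u : U u ->
  h ^+ 2 = 1 /\ forall k, \forall y \near u,
    f y 0 k + 2^-1 * tau y 0 k = f u 0 k + 2^-1 * tau u 0 k.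
Proof.
move=> Uu.
have P v (Uv : U v) := position_plus_normal_parallel oU sphi sT sm orthonormal
  phi_unit T_phi T_e h_neq0 T_norm T_trace T_biharmonic Uv.
split; first by have [] := P u Uu.
move=> k.
have sX : smooth_on U (fun v => phi k v + 2^-1 * T k v).
  by apply: smoothD => //; apply: smoothM => //; exact: smooth_cst.
apply: (locally_constant oU _ _ Uu) => [v Uv|i v Uv]; first exact: smooth_diff sX Uv.
by have [_ /(_ i k)] := P v Uv; rewrite pderE.
Qed.

Lemma tension_dot_position u : U u -> dot (tau u) (f u) = 0.
Proof. by move=> Uu; rewrite dotE; exact: T_phi. Qed.

Lemma tension_dot_pd u l : U u -> dot (pd l f u) (tau u) = 0.
Proof.
move=> Uu; rewrite dotE -[RHS](T_pder l Uu); apply: eq_bigr => n _; rewrite mulrC.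
by congr (_ * _); exact: pdf.
Qed.

Lemma position_dot_pd u l : U u -> dot (pd l f u) (f u) = 0.
Proof.
by move=> Uu; rewrite dotE -[RHS](pder_phi l Uu); apply: eq_bigr => n _; congr (_ * _); exact: pdf.
Qed.

(** Beltrami's formula: the trace of the second fundamental form of the surface in
    R^5 differs from the tension field in the sphere by - tr(g^-1 g) f. *)
Lemma laplacian_position u : U u ->
  trace_g f u (fun i j => pd i (pd j f) u - \sum_l christoffel f i j l u *: pd l f u) =
  tau u - 2 *: f u.
Proof.
move=> Uu; apply/rowP => k; rewrite trace_g_coord // mxE [X in _ + X]mxE [X in - X]mxE.
have hphiE i j : hphi i j u = - gram phi i j u.
  have : pder i (fun u => \sum_k pder j (phi k) u * phi k u) u = 0.
    by rewrite (pder_ext oU i (pder_phi j) Uu) pder_cst.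
  have sp n : smooth_on U (pder j (phi n)) by exact: smooth_pder.
  rewrite (pder_sum oU) // => [H|n]; last exact: smoothM.
  apply/eqP; rewrite -addr_eq0; apply/eqP; rewrite -[RHS]H gramE -big_split /=.
  by apply: eq_bigr => n _; rewrite (pderM _ (sp n) (sphi n) Uu); ring.
rewrite -[tau u 0 k]/(T k u) tension_coord // -(trace_gram Uu) mulr_suml -sumrB.
apply: eq_bigr => i _; rewrite mulr_suml -sumrB; apply: eq_bigr => j _.
rewrite hphiE mxE [X in _ * (_ + X)]mxE summxE pdpdf //.
have -> : \sum_l (christoffel f i j l u *: pd l f u) 0 k =
    \sum_l Gamma l i j u * pder l (phi k) u.
  by apply: eq_bigr => l _; rewrite mxE christoffelE // pdf.
by rewrite -[f u 0 k]/(phi k u); ring.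
Qed.

Let trace_g_dot A w u : dot (trace_g f u A) w =
  \sum_i \sum_j invmx (metric f u) i j * dot (A i j) w.
Proof.
rewrite /trace_g dot_suml; apply: eq_bigr => i _; rewrite dot_suml.
by apply: eq_bigr => j _; rewrite dotZl.
Qed.

(** Pair Beltrami's formula with w: the left-hand side is the Laplacian of the
    height, which is zero. *)
Lemma tension_of_locally_constant_height w u : U u ->
  (\forall y \near u, dot (f y) w = dot (f u) w) -> dot (tau u) w = 2 * dot (f u) w.
Proof.
move=> Uu Hc; suff : dot (tau u - 2 *: f u) w = 0.
  by rewrite dotBl dotZl => /eqP; rewrite subr_eq0 => /eqP.
have nU : \forall y \near u, U y by exact: open_nbhs_nbhs (conj oU Uu).
have Dg (g : V -> R) (c : R) i : (\forall y \near u, g y = c) ->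
    \forall y \near u, pder i g y = 0.
  move=> /near_join; apply: filterS => y gc.
  rewrite -(pder_cst i c y) !pderE; exact: near_eq_derive.
pose gw y := \sum_k phi k y * w 0 k.
have gwE : \forall y \near u, gw y = dot (f u) w.
  by apply: filterS Hc => y <-; rewrite dotE.
have sw k : smooth_on U (fun=> w 0 k : R) by exact: smooth_cst.
have D1 l y : U y -> pder l gw y = dot (pd l f y) w.
  move=> Uy; rewrite /gw (pder_sum oU) // => [|k]; last exact: smoothM.
  rewrite dotE; apply: eq_bigr => k _; rewrite (pderM _ (sphi k) (sw k) Uy).
  by rewrite pder_cst mulr0 addr0 pdf.
have D2 i j : pder i (pder j gw) u = dot (pd i (pd j f) u) w.
  rewrite (pder_ext oU i (g := fun y => \sum_k pder j (phi k) y * w 0 k)) // => [|y Uy].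
    have sp n : smooth_on U (pder j (phi n)) by exact: smooth_pder.
    rewrite (pder_sum oU) // => [|k]; last exact: smoothM.
    rewrite dotE; apply: eq_bigr => k _; rewrite (pderM _ (sp k) (sw k) Uu).
    by rewrite pder_cst mulr0 addr0 pdpdf.
  by rewrite D1 // dotE; apply: eq_bigr => k _; rewrite pdf.
rewrite -laplacian_position // trace_g_dot big1 // => i _; rewrite big1 // => j _.
rewrite dotBl dot_suml -D2 (nbhs_singleton (Dg _ _ i (Dg _ _ j gwE))) sub0r.
rewrite big1 ?oppr0 ?mulr0 // => l _; rewrite dotZl -D1 //.
by rewrite (nbhs_singleton (Dg _ _ l gwE)) mulr0.
Qed.

(** Let L = tau - 2 f, the trace of the second fundamental form in R^5. It is
    orthogonal to v and proportional to the component f - <f, v> v of f, hence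
    normal to the hypersphere: the projection kills it. *)
Lemma minimal_in_hypersphere v (s : R) u : U u -> s ^+ 2 = 2^-1 ->
  h ^+ 2 = 1 -> v = s *: (f u + 2^-1 *: tau u) ->
  mean_curvature_field (proj_hypersphere v) f u = 0.
Proof.
move=> Uu s2 h1 vE; have ff := f_S4 Uu; have tf := tension_dot_position Uu.
have ft : dot (f u) (tau u) = 0 by rewrite dotC.
have tt : dot (tau u) (tau u) = 4 by rewrite tension_sqr // exprMn h1; ring.
pose L := tau u - 2 *: f u.
have Lv : dot L v = 0.
  by rewrite vE /L !(dotBl, dotZl, dotZr, dotDr) ff tf ft tt; field.
have fv : dot (f u) v = s by rewrite vE !(dotZr, dotDr) ff ft; ring.
have eE : f u - dot (f u) v *: v = (- 4^-1) *: L.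
  by rewrite fv vE scalerA -expr2 s2 /L; apply/rowP => k; rewrite !mxE; field.
have LL : dot L L = 8 by rewrite /L !(dotBl, dotBr, dotZl, dotZr) ff tf ft tt; ring.
pose P := proj_hypersphere v (f u).
have PE w : P w = w - dot w v *: v - (dot w L / 8) *: L.
  rewrite /P /proj_hypersphere eE !(dotZl, dotZr) LL scalerA; congr (_ - _ *: _).
  by field.
have PF l : P (pd l f u) = pd l f u.
  have FL : dot (pd l f u) L = 0.
    by rewrite /L dotBr dotZr tension_dot_pd // position_dot_pd // mulr0 subr0.
  have Fv : dot (pd l f u) v = 0.
    by rewrite vE dotZr dotDr dotZr tension_dot_pd // position_dot_pd // mulr0 addr0 mulr0.
  by rewrite PE FL Fv mul0r !scale0r !subr0.
have PD x y : P (x + y) = P x + P y.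
  by rewrite !PE !dotDl; apply/rowP => k; rewrite !mxE; field.
have PZ a x : P (a *: x) = a *: P x.
  by rewrite !PE !dotZl; apply/rowP => k; rewrite !mxE; field.
have P0 : P 0 = 0 by rewrite -(scale0r 0) PZ !scale0r.
have PN x : P (- x) = - P x by rewrite -scaleN1r PZ scaleN1r.
have PL : P L = 0 by rewrite PE Lv LL scale0r subr0 divff ?scale1r ?subrr // pnatr_eq0.
rewrite /mean_curvature_field.
have -> : trace_g f u (fun i j => second_form (proj_hypersphere v) f i j u) = P L.
  rewrite /L -laplacian_position // /trace_g (big_morph P PD P0).
  apply: eq_bigr => i _; rewrite (big_morph P PD P0); apply: eq_bigr => j _.
  rewrite PZ PD PN (big_morph P PD P0) /second_form /nabla_along -/P.
  congr (_ *: (_ - _)); apply: eq_bigr => l _; by rewrite PZ PF.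
by rewrite PL scaler0.
Qed.

End ImmersedSurface.

(** * The axis of the hypersphere *)

Section Global.
Context {R : realType} (M : topologicalType) (S : smooth_surface R M) (phi : M -> 'rV[R]_5).
Hypothesis phi_immersion : immersion S phi.
Hypothesis phi_S4 : forall p : M, S4 (phi p).
Context (h : R) (h_neq0 : h != 0).
Hypothesis phi_cmc : forall c, atlas S c -> forall u, dom c u ->
  enorm (mean_curvature_field (@proj_S4 R) (phi \o par c) u) = h.
Hypothesis phi_biharmonic : biharmonic S (@proj_S4 R) phi.

Local Notation tau c := (tension (@proj_S4 R) (phi \o par c)).

Let s : R := (Num.sqrt 2)^-1.

Let s2 : s ^+ 2 = 2^-1.
Proof. by rewrite /s exprVn sqr_sqrtr. Qed.

Definition axis (c : chart R M) (u : 'rV[R]_2) : 'rV[R]_5 :=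
  s *: (phi (par c u) + 2^-1 *: tau c u).

Section InChart.
Context (c : chart R M) (ac : atlas S c).
Local Notation f := (phi \o par c).

Let sf : smooth_on (dom c) f.
Proof. by have [] := phi_immersion ac. Qed.

Let f_imm u : dom c u -> forall v, 'D_v f u = 0 -> v = 0.
Proof. by have [_] := phi_immersion ac; apply. Qed.

Let f_S4 u : dom c u -> dot (f u) (f u) = 1.
Proof. by move=> _; rewrite -sqr_enorm [enorm _]phi_S4 expr1n. Qed.

Let parallel u (Uu : dom c u) := unit_mean_curvature_parallel (@dom_open _ _ c) sf f_imm f_S4
  h_neq0 (phi_cmc ac) (phi_biharmonic ac) Uu.

Lemma axis_unit u : dom c u -> dot (axis c u) (axis c u) = 1.
Proof.
move=> Uu; have [h1 _] := parallel Uu.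
have tt := tension_sqr (phi_cmc ac) Uu.
have tf := tension_dot_position (@dom_open _ _ c) sf f_imm f_S4 Uu.
have ft : dot (phi (par c u)) (tau c u) = 0 by rewrite dotC.
rewrite /axis !(dotZl, dotZr, dotDl, dotDr) tt tf ft [dot (phi _) _](f_S4 Uu).
by rewrite exprMn h1 mulrA -expr2 s2; field.
Qed.

Lemma axis_height u : dom c u -> \forall y \near u, dot (f y) (axis c u) = s.
Proof.
move=> Uu; have [_ Vcst] := parallel Uu.
have nU : \forall y \near u, dom c y by exact: open_nbhs_nbhs (conj (@dom_open _ _ c) Uu).
have : \forall y \near u, forall k,
    f y 0 k + 2^-1 * tau c y 0 k = f u 0 k + 2^-1 * tau c u 0 k.
  exact: (@filter_forall _ _ (fun k y =>
    f y 0 k + 2^-1 * tau c y 0 k = f u 0 k + 2^-1 * tau c u 0 k) (nbhs u) _ Vcst).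
apply: filterS2 nU => z Uz E.
have -> : axis c u = axis c z.
  have row_eq (x y x' y' : 'rV[R]_5) :
      (forall k, x' 0 k + 2^-1 * y' 0 k = x 0 k + 2^-1 * y 0 k) ->
      s *: (x + 2^-1 *: y) = s *: (x' + 2^-1 *: y').
    by move=> H; congr (_ *: _); apply/rowP => k; rewrite !mxE H.
  exact: (row_eq _ _ _ _ E).
have tf := tension_dot_position (@dom_open _ _ c) sf f_imm f_S4 Uz.
rewrite /axis dotZr dotDr dotZr [dot _ (tau c z)]dotC tf [dot (phi _) _](f_S4 Uz).
by rewrite mulr0 addr0 mulr1.
Qed.

Lemma axis_height_surface u : dom c u ->
  \forall q \near par c u, dot (phi q) (axis c u) = s.
Proof.
move=> Uu; have := axis_height Uu.
have nU : \forall y \near u, dom c y by exact: open_nbhs_nbhs (conj (@dom_open _ _ c) Uu).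
move=> /(filterI nU); rewrite nbhsE => -[B [oB Bu] Bsub].
have BU : B `<=` dom c by move=> y /Bsub [].
have : nbhs (par c u) (par c @` B).
  by apply: open_nbhs_nbhs; split; [exact: par_open|exists u].
by apply: filterS => q [y By <-]; have [] := Bsub y By.
Qed.

(** The height of the surface along v being locally constant, v has the same scalar
    products with f and tau as the axis, so <axis, v> = 1 between unit vectors. *)
Lemma axis_unique v u : dom c u -> dot v v = 1 ->
  (\forall q \near par c u, dot (phi q) v = s) -> v = axis c u.
Proof.
move=> Uu vv Hv.
have Hf : \forall y \near u, dot (f y) v = s by exact: (par_continuous Uu) Hv.
have fv : dot (phi (par c u)) v = s := nbhs_singleton Hf.
have tv : dot (tau c u) v = 2 * s.
  rewrite -fv; apply: (tension_of_locally_constant_height (@dom_open _ _ c) sf f_imm f_S4 Uu).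
  by apply: filterS Hf => y ->; rewrite [dot _ _]fv.
have av : dot (axis c u) v = 1.
  rewrite /axis dotZl dotDl dotZl tv fv mulKf ?pnatr_eq0 //.
  by rewrite mulrDr -expr2 s2; field.
apply/eqP; rewrite -subr_eq0; apply/eqP/dot_eq0.
by rewrite dotBl !dotBr vv av axis_unit // (dotC v) av !subrr.
Qed.

Lemma minimal_axis u : dom c u ->
  mean_curvature_field (proj_hypersphere (axis c u)) f u = 0.
Proof.
move=> Uu; have [h1 _] := parallel Uu.
exact: (minimal_in_hypersphere (@dom_open _ _ c) sf f_imm f_S4 (phi_cmc ac) Uu s2 h1).
Qed.

End InChart.

(** The points near which the surface has height s along the axis at u0 form an
    open set; it is closed by axis_unique, because near a limit point the surface
    also has height s along the axis at that point. *)
Lemma axis_constant c0 u0 : connected [set: M] -> atlas S c0 -> dom c0 u0 ->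
  forall c u, atlas S c -> dom c u -> axis c0 u0 = axis c u.
Proof.
move=> M_conn ac0 Uu0; pose v0 := axis c0 u0.
have v0v0 : dot v0 v0 = 1 by exact: axis_unit.
pose A := [set p : M | \forall q \near p, dot (phi q) v0 = s].
have AT : A = [set: M].
  apply: M_conn.
  - by exists (par c0 u0); exact: axis_height_surface.
  - exists A; last by rewrite setTI.
    by rewrite openE => p /near_join.
  - exists A; last by rewrite setTI.
    move=> p clp; have [c ac [u Uu pE]] := atlas_cover S p.
    have H : \forall q \near p, dot (phi q) (axis c u) = s.
      by rewrite -pE; exact: axis_height_surface.
    have [q [Aq Hq]] := clp _ (near_join H).
    have [c' ac' [u' Uu' qE]] := atlas_cover S q.
    move: Aq Hq; rewrite /A /= -qE => Aq Hq.
    have E0 : v0 = axis c' u' := axis_unique ac' Uu' v0v0 Aq.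
    have E1 : axis c u = axis c' u' := axis_unique ac' Uu' (axis_unit ac Uu) Hq.
    by rewrite /A /= E0 -E1.
move=> c u ac Uu; have Au : A (par c u) by rewrite AT.
exact: (axis_unique ac Uu v0v0 Au).
Qed.

End Global.

Theorem theorem3p1 (R : realType) (M : topologicalType)
    (S : smooth_surface R M) (phi : M -> 'rV[R]_5)
    (M_connected : connected [set: M])
    (phi_immersion : immersion S phi)
    (phi_S4 : forall p : M, S4 (phi p))
    (phi_proper_biharmonic : proper_biharmonic S (@proj_S4 R) phi)
    (phi_cmc : constant_mean_curvature S (@proj_S4 R) phi) :
  exists v : 'rV[R]_5,
    enorm v = 1 /\
    (forall p : M, hypersphere v (phi p)) /\
    minimal S (proj_hypersphere v) phi.
Proof.
have [bih nharm] := phi_proper_biharmonic; have [h cmc] := phi_cmc.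
have [c0 [ac0 [u0 [Uu0 t0]]]] : exists c, atlas S c /\ exists u, dom c u /\
    tension (@proj_S4 R) (phi \o par c) u <> 0.
  apply: contrapT => H; apply: nharm => c ac u Uu; apply: contrapT => t0.
  by apply: H; exists c; split => //; exists u.
have h_neq0 : h != 0.
  apply/eqP => h0; apply: t0; have := cmc c0 ac0 u0 Uu0; rewrite h0 => m0.
  have /dot_eq0 : dot (mean_curvature_field (@proj_S4 R) (phi \o par c0) u0)
      (mean_curvature_field (@proj_S4 R) (phi \o par c0) u0) = 0.
    by rewrite -sqr_enorm m0 expr0n.
  by move/eqP; rewrite scaler_eq0 invr_eq0 pnatr_eq0 => /eqP.
have axisE := axis_constant phi_immersion phi_S4 h_neq0 cmc bih M_connected ac0 Uu0.
exists (axis phi c0 u0); split; last split.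
- by rewrite /enorm (axis_unit phi_immersion phi_S4 h_neq0 cmc bih ac0 Uu0) sqrtr1.
- move=> p; split; first exact: phi_S4.
  have [c ac [u Uu <-]] := atlas_cover S p; rewrite (axisE c u ac Uu).
  exact: nbhs_singleton (axis_height phi_immersion phi_S4 h_neq0 cmc bih ac Uu).
- move=> c ac u Uu; rewrite (axisE c u ac Uu).
  exact: (minimal_axis phi_immersion phi_S4 h_neq0 cmc bih ac Uu).
Qed.
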